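(* Let $\ell\ge 1$, let $q_1,\dots,q_\ell>2$ be pairwise co-prime natural numbers and let $k\ge 1$ be an integer. Let $\mathbf{K}\subset\mathbb{C}$ be a number field such that $$\mathbf{K}(\zeta_{\varphi(q_1)\cdots\varphi(q_\ell)})\cap \mathbb{Q}(\zeta_{q_1\cdots q_\ell})^{+}=\mathbb{Q}.$$ Then the numbers in the set $$X_{q_1,2k+1,o}\cup\cdots\cup X_{q_\ell,2k+1,o}$$ are linearly independent over $\mathbf{K}(\zeta_{\varphi(q_1)\cdots\varphi(q_\ell)})$.
   Context: For an integer $n\ge1$, $\zeta_n$ denotes a primitive $n$-th root of unity, $\varphi$ is Euler's totient function, and for $n>2$, $\mathbb{Q}(\zeta_n)^+=\mathbb{Q}(\zeta_n)\cap\mathbb{R}$ denotes the maximal real subfield of the $n$-th cyclotomic field. For a Dirichlet character $\chi$ modulo $q$ and $\Re(s)>1$, $L(s,\chi)=\sum_{n\ge1}\chi(n)n^{-s}$. For integers $q>2$, $m\ge1$, $X_{q,m,o}=\{L(m,\chi) : \chi \bmod q,\ \chi(-1)=-1\}$ is the set of values at $m$ of the $L$-functions of the odd Dirichlet characters modulo $q$ (characters not necessarily primitive). *)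

(* Defs.v *)
From Stdlib Require Import Reals ZArith List.
From Coquelicot Require Import Coquelicot.

Local Open Scope C_scope.

Definition is_ratC (z : C) : Prop :=
  exists (p q : Z), q <> 0%Z /\ z = RtoC (IZR p / IZR q).

Definition subfieldC (F : C -> Prop) : Prop :=
  F 0 /\ F 1 /\
  (forall x y, F x -> F y -> F (x + y)) /\
  (forall x, F x -> F (- x)) /\
  (forall x y, F x -> F y -> F (x * y)) /\
  (forall x, F x -> x <> 0 -> F (/ x)).

Fixpoint lincomb (cs xs : list C) : C :=
  match cs, xs with
  | c :: cs', x :: xs' => c * x + lincomb cs' xs'
  | _, _ => 0
  end.

Definition number_field (K : C -> Prop) : Prop :=
  subfieldC K /\
  exists B : list C, List.Forall K B /\
    forall z, K z -> exists cs : list C,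
      length cs = length B /\ List.Forall is_ratC cs /\ z = lincomb cs B.

Definition gen_field (S : C -> Prop) (z : C) : Prop :=
  forall F, subfieldC F -> (forall x, S x -> F x) -> F z.

Definition adjoin (K : C -> Prop) (a : C) : C -> Prop :=
  gen_field (fun x => K x \/ x = a).

Definition zeta (n : nat) : C :=
  (cos (2 * PI / INR n), sin (2 * PI / INR n)).

Definition cyclo (n : nat) : C -> Prop := gen_field (fun x => x = zeta n).
Definition cyclo_plus (n : nat) (z : C) : Prop := cyclo n z /\ Im z = 0%R.

Definition phi (n : nat) : nat :=
  length (filter (fun j => Nat.eqb (Nat.gcd j n) 1%nat) (seq 1%nat n)).

Definition prodn (l : nat) (f : nat -> nat) : nat :=
  fold_right Nat.mul 1%nat (map f (seq 0%nat l)).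

Definition dirichlet_char (q : nat) (chi : Z -> C) : Prop :=
  chi 1%Z = 1 /\
  (forall m n, chi (m * n)%Z = chi m * chi n) /\
  (forall n, chi (n + Z.of_nat q)%Z = chi n) /\
  (forall n, chi n <> 0 <-> Z.gcd n (Z.of_nat q) = 1%Z).

Definition L_value (m : nat) (chi : Z -> C) (v : C) : Prop :=
  is_series (fun n : nat => chi (Z.of_nat (S n)) / RtoC (INR (S n) ^ m)) v.

Definition X_odd (q m : nat) (z : C) : Prop :=
  exists chi, dirichlet_char q chi /\ chi (-1)%Z = - (1) /\ L_value m chi z.

Definition lin_indep_over (F S : C -> Prop) : Prop :=
  forall xs cs : list C,
    length cs = length xs -> NoDup xs -> List.Forall S xs -> List.Forall F cs ->
    lincomb cs xs = 0 -> List.Forall (fun c : C => c = 0) cs.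

(* Main.v *)
From HB Require Import structures.
From Stdlib Require Import Reals ZArith List Lra Lia Psatz.
From Coquelicot Require Import Coquelicot.
From mathcomp Require all_boot all_order all_algebra all_field all_solvable.
From mathcomp Require boolp Rstruct complex ring zify.
Require Import Defs.

(** Let m = 2k+1, Q = q_1...q_l, z = zeta_Q and let F be the field of
    coefficients.  For w = zeta_(qM), group the finite sums
    M^-m * sum_(n < qM) chi(n) / (1 - w^n)^m according to n mod q: by Newton's
    identities each class contributes a quantity that converges, as M grows, to
    a rational polynomial in 1/(1 - zeta_q^b).  Taking the limit termwise
    instead gives a multiple of L(m, chi) when chi and m are odd.  Hence
    L(m, chi) = kappa * sum_b chi(b) S_q(zeta_q^b) with S_q rational and kappa
    depending on m only.

    A relation sum_t c_t L(m, chi_t) = 0 over F therefore reads W(z) = 0 for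
    some W in F[X], and W(z^b) is kappa^-1 * sum_t c_t L(m, chi_t) / chi_t(b)
    for b prime to Q, which is odd in b.  The minimal polynomial of z + 1/z over
    F has all its roots among the z^j + z^-j, so its coefficients lie in
    F and in Q(z)^+, hence are rational; thus W(z^b) = 0 for all b prime to Q.
    The characters 1/chi_t are distinct on the integers prime to Q, so they are
    linearly independent, and c_t L(m, chi_t) = 0.  Finally L(m, chi_t) <> 0
    because |L(m, chi_t) - 1| <= zeta(3) - 1 < 1. *)

Module CyclotomicPowerSums.

Import all_boot all_order all_algebra all_field all_solvable.
Import boolp Rstruct complex ring zify.
Set Implicit Arguments. Unset Strict Implicit. Unset Printing Implicit Defensive.
Import GRing.Theory Num.Theory.
Delimit Scope R_scope with Re.
Delimit Scope C_scope with C.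
Delimit Scope Z_scope with ZZ.
Local Open Scope ring_scope.

(** * Conjugates of z + 1/z over a field meeting Q(z)^+ in Q *)

(** X^n - 1 is the product of the Phi_d with d | n, so z is a root of some Phi_d; then z^d = 1 and
    primitivity gives n | d, hence d = n. *)
Lemma root_Cyclotomic_prim (L : numFieldType) n (z : L) :
  (0 < n)%N -> n.-primitive_root z -> root (map_poly intr 'Phi_n) z.
Proof.
move=> n_gt0 zP.
have: root ('X^n - 1) z by rewrite rootE !hornerE prim_expr_order ?subrr.
have -> : 'X^n - 1 = map_poly intr ('X^n - 1 : {poly int}) :> {poly L}.
  by rewrite rmorphB /= map_polyXn rmorph1.
rewrite -(prod_Cyclotomic n_gt0) rmorph_prod /= => r.
have [d dn rd] : exists2 d, d \in divisors n & root (map_poly intr 'Phi_d) z.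
  move: r; rewrite rootE horner_prod prodf_seq_eq0 => /hasP[d dn /=] rd.
  by exists d.
have d_gt0 : (0 < d)%N by move: dn; rewrite -dvdn_divisors // => /dvdn_gt0; apply.
have zd : z ^+ d = 1.
  apply/eqP; rewrite -subr_eq0.
  have : root (map_poly intr ('X^d - 1 : {poly int})) z.
    rewrite -(prod_Cyclotomic d_gt0) rmorph_prod /= (perm_big (d :: rem d (divisors d))).
      by rewrite big_cons rootM rd.
    by apply: perm_to_rem; rewrite -dvdn_divisors.
  by rewrite rmorphB /= map_polyXn rmorph1 rootE !hornerE.
have nd : (n %| d)%N by rewrite (prim_order_dvd zP) zd.
suff <- : d = n by [].
by apply/eqP; rewrite eqn_dvd nd andbT dvdn_divisors.
Qed.

(* In other words, the cyclotomic polynomial is irreducible over rat. *)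
Lemma rat_root_prim_exp (L : numFieldType) n (z : L) (S : {poly rat}) b :
  (0 < n)%N -> n.-primitive_root z -> coprime b n ->
  root (map_poly ratr S) z -> root (map_poly ratr S) (z ^+ b).
Proof.
move=> n_gt0 zP cb Sz.
pose P : {poly rat} := map_poly intr 'Phi_n.
have PL : forall M : numFieldType,
    map_poly ratr P = map_poly intr 'Phi_n :> {poly M}.
  by move=> M; rewrite -map_poly_comp; apply: eq_map_poly => x /=; rewrite ratr_int.
have Pz w : n.-primitive_root w -> root (map_poly ratr P : {poly L}) w.
  by move=> wP; rewrite PL root_Cyclotomic_prim.
(* The gcd with the cyclotomic polynomial has the root z, so it is not constant. Any root of it in
   [algC] is a primitive n-th root of unity, whose minimal polynomial is the cyclotomic one; the
   latter therefore divides S. *)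
pose g := gcdp S P.
have gz : root (map_poly ratr g) z by rewrite gcdp_map root_gcd Sz Pz.
have g1 : size (map_poly (ratr : rat -> algC) g) != 1%N.
  rewrite size_map_poly; apply/negP => /size_poly1P[c c0 gc].
  by move: gz; rewrite gc map_polyC rootC fmorph_eq0 (negPf c0).
have [x gx] := closed_rootP _ g1.
have [y yP] := C_prim_root_exists n_gt0.
have xP : n.-primitive_root x.
  rewrite -(root_cyclotomic yP) -Cintr_Cyclotomic // -PL.
  by move: gx; rewrite gcdp_map root_gcd => /andP[].
have [p [pE _] pdv] := minCpolyP x.
have pP : p = P.
  apply: (map_poly_inj (ratr : {rmorphism rat -> algC})).
  by rewrite -pE (minCpoly_cyclotomic xP) -(Cintr_Cyclotomic xP) PL.
have: p %| S by rewrite (dvdp_trans _ (dvdp_gcdl S P)) // -pdv.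
rewrite pP -(dvdp_map (ratr : {rmorphism rat -> L})) => PS.
apply: (root_dvdp PS); apply: Pz.
by rewrite prim_root_exp_coprime.
Qed.

(** The rescaled Chebyshev polynomials 2 T_n(X/2), which send x + 1/x to x^n + x^-n. *)
Fixpoint cheb (R : nzRingType) n : {poly R} :=
  match n with
  | 0 => 2%:P
  | 1 => 'X
  | (n''.+1 as n').+1 => 'X * cheb R n' - cheb R n''
  end.

Lemma cheb_eval (R : comNzRingType) n (x y : R) :
  x * y = 1 -> (cheb R n).[x + y] = x ^+ n + y ^+ n.
Proof.
move=> xy.
suff: (cheb R n).[x + y] = x ^+ n + y ^+ n /\
      (cheb R n.+1).[x + y] = x ^+ n.+1 + y ^+ n.+1 by case.
elim: n => [|n [IH1 IH2]]; first by rewrite /= !hornerE !expr0 !expr1.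
split=> //.
rewrite [cheb R _]/= -/(cheb R n.+1) hornerD hornerN hornerM hornerX IH1 IH2.
by rewrite -[X in _ - X]mul1r -xy !exprS; ring.
Qed.

Lemma cheb_over (R : nzRingType) (F : subringClosed R) n :
  cheb R n \is a polyOver F.
Proof.
suff: cheb R n \is a polyOver F /\ cheb R n.+1 \is a polyOver F by case.
elim: n => [|n [IH1 IH2]].
  by rewrite /= polyOverX polyOverC rpred_nat.
by split=> //=; rewrite rpredB // rpredM // polyOverX.
Qed.

(** x is a root of X^2 - y X + 1, whose two roots have product 1 and sum y. *)
Lemma exists_add_inv (L : numClosedFieldType) (y : L) :
  exists2 x, x != 0 & y = x + x^-1.
Proof.
pose s := sqrtC (y ^+ 2 - 4); pose x := (y + s) / 2.
have sE : s ^+ 2 = y ^+ 2 - 4 by rewrite sqrtCK.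
have xE : x * (y - x) = 1.
  rewrite /x; apply: (@mulfI _ 4); first by rewrite pnatr_eq0.
  rewrite mulr1; transitivity (y ^+ 2 - s ^+ 2); first by field.
  by rewrite sE; ring.
have x0 : x != 0.
  by apply/eqP => x0; move/eqP: xE; rewrite x0 mul0r eq_sym oner_eq0.
exists x => //; rewrite -[x^-1]mulr1 -xE mulrA mulVf // mul1r; ring.
Qed.

(** The equation x^n + x^-n = 2 amounts to (x^n - 1)^2 = 0. *)
Lemma cheb_eq2 (L : fieldType) n (x : L) : x != 0 ->
  (cheb L n).[x + x^-1] = 2 -> x ^+ n = 1.
Proof.
move=> x0; rewrite cheb_eval ?divff // exprVn => e.
have xn0 : x ^+ n != 0 by rewrite expf_neq0.
have : (x ^+ n - 1) ^+ 2 == 0.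
  have : x ^+ n * (x ^+ n + x ^- n) = x ^+ n * 2 by rewrite e.
  rewrite mulrDr divff // => e'; apply/eqP.
  transitivity (x ^+ n * x ^+ n + 1 - x ^+ n * 2); first by ring.
  by rewrite e' subrr.
by rewrite expf_eq0 /= subr_eq0 => /eqP.
Qed.

(** Euclidean division by a monic polynomial of least degree, carried out by hand because F is a
    closed predicate on L rather than a field type. *)
Lemma minimal_monic_dvd (L : fieldType) (F : divringClosed L) (t : L)
    (P0 : {poly L}) : P0 != 0 -> P0 \is a polyOver F -> root P0 t ->
  exists D : {poly L}, [/\ D \is monic, D \is a polyOver F, root D t &
    forall P, P \is a polyOver F -> root P t -> D %| P].
Proof.
move=> P00 P0F P0t.
pose A := fun n : nat => `[< exists D : {poly L}, [/\ D \is monic,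
  D \is a polyOver F, root D t & size D = n] >].
have monicA (P : {poly L}) : P != 0 -> P \is a polyOver F -> root P t ->
    A (size P).
  move=> P0' PF Pt; apply/asboolP; exists ((lead_coef P)^-1 *: P).
  have l0 : lead_coef P != 0 by rewrite lead_coef_eq0.
  split.
  - by rewrite monicE lead_coefZ mulVf.
  - by rewrite polyOverZ // rpredV; apply: (polyOverP PF).
  - by rewrite rootZ ?invr_eq0.
  - by rewrite size_scale // invr_eq0.
have exA : exists n, A n by exists (size P0); apply: monicA.
case: (ex_minnP exA) => n /asboolP[D [Dm DF Dt sD]] minD.
exists D; split=> // P; have [s] := ubnP (size P).
elim: s P => // s IH P; rewrite ltnS => sP PF Pt.
have [->|Pn0] := eqVneq P 0; first by rewrite dvdp0.
have sDP : (size D <= size P)%N by rewrite sD minD // monicA.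
have D0 := monic_neq0 Dm.
(* One division step: the leading terms cancel, so [P'] is shorter than P and the induction
   applies. *)
pose P' := P - lead_coef P *: 'X^(size P - size D) * D.
have -> : P = P' + lead_coef P *: 'X^(size P - size D) * D by rewrite subrK.
rewrite dvdp_addl ?dvdp_mull //; apply: IH; last first.
- by rewrite rootE /P' !hornerE (rootP Pt) (rootP Dt) mulr0 subrr.
- rewrite rpredB // rpredM // polyOverZ ?polyOverXn //.
  exact: (polyOverP PF).
apply: leq_trans sP; rewrite /P' -scalerAl.
have sP0 : (0 < size P)%N by rewrite size_poly_gt0.
have sD0 : (0 < size D)%N by rewrite size_poly_gt0.
have lE : lead_coef (lead_coef P *: ('X^(size P - size D) * D)) = lead_coef P.
  by rewrite lead_coefZ lead_coefM lead_coefXn (monicP Dm) !mulr1.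
have sE : size (lead_coef P *: ('X^(size P - size D) * D)) = size P.
  rewrite size_scale ?lead_coef_eq0 // mulrC size_mulXn //.
  by rewrite subnK.
rewrite -[ltnRHS](prednK sP0) ltnS; apply/leq_sizeP => j.
rewrite leq_eqVlt => /predU1P[<-|jlt].
  by move: lE; rewrite coefB [LHS]lead_coefE sE => ->; rewrite lead_coefE subrr.
rewrite coefB !nth_default ?subrr //; first by rewrite sE; move: jlt; rewrite prednK.
by move: jlt; rewrite prednK.
Qed.

Section RealSubfieldConjugates.

Variables (L : numClosedFieldType) (F : divringClosed L) (E : subringClosed L).
Variables (n : nat) (z : L).
Hypotheses (n_gt2 : (2 < n)%N) (zP : n.-primitive_root z).
Hypothesis zE : forall j, z ^+ j + z ^- j \in E.
Hypothesis FE : forall x, x \in F -> x \in E -> exists r : rat, x = ratr r.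

Let n_gt0 : (0 < n)%N := ltn_trans (ltn0Sn 1) n_gt2.

Let z_neq0 : z != 0.
Proof.
apply/eqP => z0; move: (prim_expr_order zP) => /eqP.
by rewrite z0 expr0n gtn_eqF // eq_sym oner_eq0.
Qed.

(* The monic D of least degree over F killing z + 1/z divides T_n - 2, so its
   roots are all of the form z^j + z^-j; its coefficients therefore lie in both
   F and E, hence are rational, and irreducibility of the n-th cyclotomic
   polynomial applies to D(X + 1/X). *)
Lemma root_real_conjugate (P : {poly L}) b : P \is a polyOver F ->
  root P (z + z^-1) -> coprime b n -> root P (z ^+ b + z ^- b).
Proof.
move=> PF Pz cb.
pose Psi := cheb L n - 2%:P.
have Psi_root x : x != 0 -> root Psi (x + x^-1) -> x ^+ n = 1.
  move=> x0; rewrite rootE !hornerE subr_eq0 => /eqP; exact: cheb_eq2.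
have Psi0 : Psi != 0.
  (* At x = 2 a vanishing [Psi] would force 2^n = 1. *)
  apply/eqP => P0; have /Psi_root : (2 : L) != 0 by rewrite pnatr_eq0.
  rewrite P0 root0 => /(_ isT) /eqP.
  by rewrite -natrX (eqr_nat L _ 1) -(expn0 2) eqn_exp2l // gtn_eqF.
have PsiF : Psi \is a polyOver F.
  by rewrite rpredB ?cheb_over // polyOverC rpred_nat.
have Psiz : root Psi (z + z^-1).
  rewrite rootE !hornerE cheb_eval ?divff // exprVn (prim_expr_order zP).
  by rewrite invr1 subr_eq0.
have [D [Dm DF Dz Ddv]] := minimal_monic_dvd Psi0 PsiF Psiz.
have DE : D \is a polyOver E.
  have [rs Drs] := closed_field_poly_normal D.
  rewrite (monicP Dm) scale1r in Drs.
  rewrite Drs big_seq rpred_prod // => y yrs; rewrite polyOverXsubC.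
  have Dy : root D y by rewrite Drs root_prod_XsubC.
  have Py : root Psi y by apply: (root_dvdp (Ddv _ PsiF Psiz)).
  have [x x0 yx] := exists_add_inv y.
  have xn : x ^+ n = 1 by apply: Psi_root; rewrite -?yx.
  by have [j xj] := prim_rootP zP xn; rewrite yx xj zE.
have [D0 DD0] : exists D0 : {poly rat}, D = map_poly ratr D0.
  have /choice[f fP] i : exists r : rat, D`_i = ratr r.
    by apply: FE; [apply: (polyOverP DF)|apply: (polyOverP DE)].
  exists (\poly_(i < size D) f i); apply/polyP => i.
  rewrite coef_map coef_poly /=; case: ltnP => si; first exact: fP.
  by rewrite nth_default // raddf0.
(* At n-th roots of unity X^(n-1) takes the value 1/x, so the polynomial S computes D(x + 1/x)
   there. *)
pose S : {poly rat} := D0 \Po ('X + 'X^(n.-1)).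
have Sx x : x ^+ n = 1 -> (map_poly ratr S : {poly L}).[x] = D.[x + x^-1].
  move=> xn; rewrite map_comp_poly horner_comp -DD0; congr (D.[_]).
  rewrite rmorphD /= map_polyX map_polyXn !hornerE; congr (_ + _).
  have x0 : x != 0.
    by apply/eqP => x0; move/eqP: xn; rewrite x0 expr0n gtn_eqF // eq_sym oner_eq0.
  by apply: (mulfI x0); rewrite -exprS prednK // xn divff.
have zn := prim_expr_order zP.
have Sz : root (map_poly ratr S) z by rewrite rootE Sx.
have := rat_root_prim_exp n_gt0 zP cb Sz.
rewrite rootE Sx; last by rewrite exprAC zn expr1n.
move=> Db; apply: root_dvdp (Ddv _ PF Pz) _.
by rewrite rootE.
Qed.

(** Multiplication by X - 1/X turns the odd function b -> W(z^b) into an even one, which is a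
    polynomial over F in z^b + z^-b; [root_real_conjugate] applies to that polynomial. *)
Lemma odd_vanishing_conjugate (W : {poly L}) b : W \is a polyOver F ->
  (forall a, coprime a n -> W.[z ^- a] = - W.[z ^+ a]) ->
  W.[z] = 0 -> coprime b n -> W.[z ^+ b] = 0.
Proof.
move=> WF Wodd Wz cb; have zn := prim_expr_order zP.
pose V := ('X - 'X^(n.-1)) * W.
have VF : V \is a polyOver F by rewrite rpredM // rpredB ?polyOverX ?polyOverXn.
have invE (x : L) : x ^+ n = 1 -> x ^+ n.-1 = x^-1.
  move=> xn.
  have x0 : x != 0.
    by apply/eqP => x0; move/eqP: xn; rewrite x0 expr0n gtn_eqF // eq_sym oner_eq0.
  by apply: (mulfI x0); rewrite -exprS prednK // xn divff.
have zan a : (z ^+ a) ^+ n = 1 by rewrite exprAC zn expr1n.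
have Vx x : x ^+ n = 1 -> V.[x] = (x - x^-1) * W.[x].
  by move=> xn; rewrite /V !hornerE invE.
have Veven a : coprime a n -> V.[z ^- a] = V.[z ^+ a].
  move=> ca; rewrite !Vx // ?exprVn ?zan ?invr1 // Wodd // invrK.
  by rewrite mulrN -mulNr opprB.
(* Averaging V at x and 1/x replaces each x^j by (x^j + x^-j)/2, that is by half of [cheb L j] at x
   + 1/x. *)
pose P := \sum_(j < size V) (V`_j / 2) *: cheb L j.
have PF : P \is a polyOver F.
  apply: rpred_sum => j _; rewrite polyOverZ ?cheb_over //.
  by rewrite rpred_div ?rpred_nat // (polyOverP VF).
have PV a : coprime a n -> P.[z ^+ a + z ^- a] = V.[z ^+ a].
  move=> ca; transitivity ((V.[z ^+ a] + V.[z ^- a]) / 2); last first.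
    by rewrite Veven // -mulr2n -[_ *+ 2]mulr_natr mulfK // pnatr_eq0.
  rewrite ![V.[_]]horner_coef -big_split /= mulr_suml horner_sum.
  apply: eq_bigr => j _; rewrite hornerZ cheb_eval ?divff ?expf_neq0 //.
  by rewrite -mulrDr mulrAC.
have Pz : root P (z + z^-1).
  by rewrite rootE -[z]expr1 PV ?coprime1n // Vx ?zan // expr1 Wz mulr0.
have := root_real_conjugate PF Pz cb; rewrite rootE PV // Vx // mulf_eq0.
(* The extra factor vanishes only if z^(2b) = 1; as b is prime to n this gives n | 2, against n >
   2. *)
case/orP => [|/eqP//]; rewrite subr_eq0 => /eqP e.
have : (z ^+ b) ^+ 2 == 1 by rewrite expr2 {2}e divff // expf_neq0.
rewrite -exprM -(prim_order_dvd zP) Gauss_dvdr; last by rewrite coprime_sym.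
by move=> /(dvdn_leq (ltn0Sn _)); rewrite leqNgt n_gt2.
Qed.

End RealSubfieldConjugates.

(** * Power sums of 1/(1 - v) over the roots of v^M = U *)

Lemma sum_expr_eq0 (K : fieldType) M (x : K) :
  x ^+ M = 1 -> x != 1 -> \sum_(j < M) x ^+ j = 0.
Proof.
move=> xM x1; apply/eqP; have := subrX1 x M; rewrite xM subrr => /esym/eqP.
by rewrite mulf_eq0 subr_eq0 (negPf x1).
Qed.

(** A differentiated geometric sum. When M is invertible it expresses 1/(1 - x) as a polynomial in x
    with rational coefficients, the same for all M-th roots of unity x other than 1. *)
Lemma sum_mul_expr (K : fieldType) M (x : K) : x ^+ M = 1 -> x != 1 ->
  (1 - x) * \sum_(j < M) j%:R * x ^+ j = - M%:R.
Proof.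
move=> xM x1.
(* For k = 0 the empty sums leave -1 on the right, which the indicator of k = 0 cancels. *)
suff E k : (1 - x) * \sum_(j < k) j%:R * x ^+ j =
           \sum_(j < k) x ^+ j - 1 - k.-1%:R * x ^+ k + (k == 0)%:R.
  case: M => [|M] in xM *; first by rewrite big_ord0 mulr0 oppr0.
  by rewrite E xM mulr1 (sum_expr_eq0 xM x1) /= -addn1 natrD /=; ring.
elim: k => [|k IH]; first by rewrite !big_ord0 mulr0 /=; ring.
rewrite !big_ord_recr /= mulrDr IH.
case: k {IH} => [|k] /=; first by rewrite !big_ord0; ring.
by rewrite [k.+1%:R]mulrS !exprS; ring.
Qed.

(** The reflection n -> N - n of exponents acts on y = 1/(1 - w^n) by y -> 1 - y. *)
Lemma inv_1subV (K : fieldType) (x : K) : x != 0 -> 1 - x != 0 ->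
  (1 - x^-1)^-1 = 1 - (1 - x)^-1.
Proof.
move=> x0 x1; have x1' : x - 1 != 0 by rewrite -opprB oppr_eq0.
by field; rewrite x0 x1 x1'.
Qed.

Section InversePowerSums.

Variables (K : fieldType) (M : nat) (w u U : K).
Hypotheses (wP : M.-primitive_root w) (uU : u ^+ M = U) (U1 : U != 1).

Let v (j : nat) := u * w ^+ j.
Definition inv_psum k := \sum_(j < M) ((1 - u * w ^+ j)^-1) ^+ k.

Let vM j : v j ^+ M = U.
Proof. by rewrite exprMn uU exprAC (prim_expr_order wP) expr1n mulr1. Qed.

Let v1 j : 1 - v j != 0.
Proof.
rewrite subr_eq0 eq_sym; apply: contraNneq U1 => e.
by rewrite -(vM j) e expr1n.
Qed.

Let sum_v r : (0 < r < M)%N -> \sum_(j < M) v j ^+ r = 0.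
Proof.
case/andP=> r0 rM; under eq_bigr => j _ do rewrite exprMn exprAC.
rewrite -mulr_sumr sum_expr_eq0 ?mulr0 //.
  by rewrite exprAC (prim_expr_order wP) expr1n.
by rewrite -(prim_order_dvd wP) gtnNdvd.
Qed.

(** In the binomial expansion the power sums of the [v j] with exponent strictly between 0 and M
    vanish, so only the constant term survives. *)
Let sum_1v r : (r < M)%N -> \sum_(j < M) (1 - v j) ^+ r = M%:R.
Proof.
move=> rM; under eq_bigr => j _ do rewrite exprBn.
rewrite exchange_big /= big_ord_recl /= [X in _ + X]big1 ?addr0 => [|i _].
  under eq_bigr => j _ do rewrite bin0 expr1n !expr0 !mulr1 mulr1n.
  by rewrite sumr_const card_ord.
under eq_bigr => j _ do rewrite expr1n mulr1 -mulrnAl.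
by rewrite -mulr_sumr sum_v ?mulr0 // /bump; have := ltn_ord i; lia.
Qed.

(* Newton's identities for the M numbers 1/(1 - v), where v runs over the
   M-th roots of U. *)
Lemma inv_psum_rec m : (0 < m <= M)%N ->
  (1 - U) * inv_psum m =
    M%:R * \sum_(k < m) (-1) ^+ k * 'C(M, k)%:R
    - \sum_(1 <= k < m) (-1) ^+ k * 'C(M, k)%:R * inv_psum (m - k).
Proof.
case/andP=> m0 mM.
(* U = v^M = (1 - (1 - v))^M is expanded in powers of 1 - v. *)
have E : U * inv_psum m = \sum_(k < M.+1) (-1) ^+ k * 'C(M, k)%:R *
    \sum_(j < M) ((1 - v j)^-1) ^+ m * (1 - v j) ^+ k.
  rewrite /inv_psum mulr_sumr.
  transitivity (\sum_(j < M) \sum_(k < M.+1) (-1) ^+ k * 'C(M, k)%:R *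
      (((1 - v j)^-1) ^+ m * (1 - v j) ^+ k)).
    apply: eq_bigr => j _; rewrite -(vM j) -{1}[v j](subKr 1) exprBn mulr_suml.
    apply: eq_bigr => k _; rewrite expr1n mulr1 -mulr_natr /=.
    by rewrite -/(v j); ring.
  by rewrite exchange_big /=; apply: eq_bigr => k _; rewrite mulr_sumr.
have S0 : \sum_(0 <= k < M.+1) (-1) ^+ k * 'C(M, k)%:R = 0 :> K.
  transitivity ((1 - 1 : K) ^+ M); last first.
    by rewrite subrr expr0n gtn_eqF // (leq_trans m0).
  rewrite exprBn big_mkord; apply: eq_bigr => k _.
  by rewrite !expr1n !mulr1 mulr_natr.
have mM1 : (m <= M.+1)%N by lia.
move: E; rewrite -(big_mkord xpredT (fun k => (-1) ^+ k * 'C(M, k)%:R *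
  \sum_(j < M) ((1 - v j)^-1) ^+ m * (1 - v j) ^+ k)) (big_cat_nat _ mM1) //=.
(* For k >= m no negative power is left, and the sum of (1 - v)^(k-m) over all v is M. *)
rewrite [X in _ + X](eq_big_nat _ _ (F2 := fun k => (-1) ^+ k * 'C(M, k)%:R * M%:R));
  last first.
  move=> k /andP[mk kM]; congr (_ * _); rewrite -(@sum_1v (k - m)); last by lia.
  apply: eq_bigr => j _; rewrite -{1}(subnKC mk) exprD mulrA -exprMn.
  by rewrite mulVf // expr1n mul1r.
rewrite [X in X + _](eq_big_nat _ _
  (F2 := fun k => (-1) ^+ k * 'C(M, k)%:R * inv_psum (m - k))); last first.
  move=> k /andP[_ km]; congr (_ * _); apply: eq_bigr => j _.
  rewrite -{1}(subnK (ltnW km)) exprD -mulrA -exprMn mulVf // expr1n mulr1 //.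
rewrite -mulr_suml.
(* Since the full alternating sum is 0, its tail k >= m equals minus its head k < m. *)
move: S0; rewrite (big_cat_nat _ mM1) //= big_mkord => /eqP.
rewrite addrC addr_eq0 => /eqP ->.
rewrite big_ltn // expr0 bin0 mulr1 mul1r subn0 mulrBl mul1r => ->.
by rewrite mulNr [_ * M%:R]mulrC; ring.
Qed.

End InversePowerSums.

(** * The field structure of C and limits in C *)

(** The field structure uses a total inverse that must send 0 to 0. *)
Lemma Cinv0 : Cinv 0%C = 0%C.
Proof. by rewrite /Cinv /= /Rdiv Ropp_0 !Rmult_0_l. Qed.

HB.instance Definition _ := gen_eqMixin C.
HB.instance Definition _ := gen_choiceMixin C.

Lemma Cadd_opp_l : left_inverse (RtoC 0) Copp Cplus.
Proof. by move=> x; rewrite Cplus_comm Cplus_opp_r. Qed.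

HB.instance Definition _ := GRing.isZmodule.Build C Cplus_assoc Cplus_comm Cplus_0_l
  Cadd_opp_l.

Lemma C1_neq0 : is_true (RtoC 1 != RtoC 0).
Proof. by apply/eqP => -[]; lra. Qed.

HB.instance Definition _ := GRing.Zmodule_isComNzRing.Build C Cmult_assoc Cmult_comm
  Cmult_1_l Cmult_plus_distr_r C1_neq0.

Lemma CmulVf (x : C) : is_true (x != 0%R) -> (/ x * x = 1)%C.
Proof. by move/eqP => x0; apply: Cinv_l. Qed.

HB.instance Definition _ := GRing.ComNzRing_isField.Build C CmulVf Cinv0.

(** Transfers to [complex R], which is a [numClosedFieldType] as the results on conjugates
    require. *)
Definition c2c (z : C) : complex R := Complex (fst z) (snd z).

Lemma c2c_is_additive : zmod_morphism c2c.
Proof. by move=> [a b] [c d]. Qed.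

Lemma c2c_is_mult : monoid_morphism c2c.
Proof. by split => // [[a b] [c d]]. Qed.

HB.instance Definition _ := GRing.isZmodMorphism.Build C (complex R) c2c c2c_is_additive.
HB.instance Definition _ := GRing.isMonoidMorphism.Build C (complex R) c2c c2c_is_mult.

(** Convergence is taken by coordinates, so that facts on real sequences apply directly. *)
Definition Clim (u : nat -> C) (l : C) :=
  is_lim_seq (fun n => fst (u n)) (fst l) /\
  is_lim_seq (fun n => snd (u n)) (snd l).

(* The scope bound to C would otherwise parse these arguments with Cplus, Cmult... *)
Arguments Clim _%_ring_scope _%_ring_scope.

Lemma Clim_uniq u l l' : Clim u l -> Clim u l' -> l = l'.
Proof.
move=> [h1 h2] [h1' h2']; apply: injective_projections.
- by have := is_lim_seq_unique _ _ h1; rewrite (is_lim_seq_unique _ _ h1') => -[].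
- by have := is_lim_seq_unique _ _ h2; rewrite (is_lim_seq_unique _ _ h2') => -[].
Qed.

Lemma Clim_ext_loc N u v l :
  (forall n, (N <= n)%N -> u n = v n) -> Clim u l -> Clim v l.
Proof.
move=> uv [h1 h2]; split.
- apply: is_lim_seq_ext_loc h1; exists N => n /leP Nn; by rewrite uv.
- apply: is_lim_seq_ext_loc h2; exists N => n /leP Nn; by rewrite uv.
Qed.

Lemma Clim_const c : Clim (fun=> c) c.
Proof. by split; apply: is_lim_seq_const. Qed.

Lemma ClimD u v l l' : Clim u l -> Clim v l' -> Clim (fun n => u n + v n) (l + l').
Proof. by move=> [? ?] [? ?]; split; apply: is_lim_seq_plus'. Qed.

Lemma ClimM u v l l' : Clim u l -> Clim v l' -> Clim (fun n => u n * v n) (l * l').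
Proof.
move=> [? ?] [? ?]; split.
- by apply: is_lim_seq_minus'; apply: is_lim_seq_mult'.
- by apply: is_lim_seq_plus'; apply: is_lim_seq_mult'.
Qed.

Lemma ClimN u l : Clim u l -> Clim (fun n => - u n) (- l).
Proof. by move=> [h1 h2]; split; [move/is_lim_seq_opp: h1|move/is_lim_seq_opp: h2]. Qed.

Lemma ClimX u l k : Clim u l -> Clim (fun n => u n ^+ k) (l ^+ k).
Proof.
move=> ul; elim: k => [|k IH]; first exact: Clim_const.
rewrite exprS; apply: (@Clim_ext_loc 0 (fun n => u n * u n ^+ k)).
  by move=> n _; rewrite exprS.
exact: ClimM.
Qed.

Lemma Clim_sum (I : Type) (r : seq I) (P : pred I) (u : I -> nat -> C) (l : I -> C) :
  (forall i, P i -> Clim (u i) (l i)) ->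
  Clim (fun n => \sum_(i <- r | P i) u i n) (\sum_(i <- r | P i) l i).
Proof.
move=> ul; elim: r => [|i r IH].
  rewrite big_nil; apply: (@Clim_ext_loc 0 (fun=> 0)); last exact: Clim_const.
  by move=> n _; rewrite big_nil.
rewrite big_cons; case: ifP => Pi.
  apply: (@Clim_ext_loc 0 (fun n => u i n + \sum_(i <- r | P i) u i n)).
    by move=> n _; rewrite big_cons Pi.
  by apply: ClimD => //; apply: ul.
apply: (@Clim_ext_loc 0 (fun n => \sum_(i <- r | P i) u i n)) => //.
by move=> n _; rewrite big_cons Pi.
Qed.

Lemma ClimV u l : l != 0 -> Clim u l -> Clim (fun n => (u n)^-1) l^-1.
Proof.
move=> l0 [h1 h2].
have n0 : (fst l ^ 2 + snd l ^ 2 <> 0)%Re.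
  move=> e; move/eqP: l0; apply; apply: injective_projections => /=; nra.
have hn : is_lim_seq (fun n => fst (u n) ^ 2 + snd (u n) ^ 2)%Re
    (fst l ^ 2 + snd l ^ 2)%Re.
  apply: is_lim_seq_plus' => /=; do !apply: is_lim_seq_mult' => //;
    exact: is_lim_seq_const.
split; apply: is_lim_seq_div' => //.
by move/is_lim_seq_opp: h2.
Qed.

Lemma Clim_comp u l (M : nat -> nat) :
  (forall s, (s <= M s)%N) -> Clim u l -> Clim (fun s => u (M s)) l.
Proof.
move=> Ms [h1 h2].
have M_inf : filterlim M eventually eventually.
  move=> P [N PN]; exists N => s /leP Ns; apply: PN; apply/leP.
  exact: leq_trans Ns (Ms s).
by split; [apply: (is_lim_seq_subseq _ _ _ M_inf h1)
           |apply: (is_lim_seq_subseq _ _ _ M_inf h2)].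
Qed.

Lemma natrC n : n%:R = RtoC (INR n) :> C.
Proof. by elim: n => // n IH; rewrite -addn1 natrD IH plus_INR RtoC_plus. Qed.

Lemma natrC_neq0 n : (0 < n)%N -> (n%:R : C) != 0.
Proof.
by move=> n0; apply/eqP; rewrite natrC => -[]; apply: not_0_INR; case: n n0.
Qed.

Lemma Clim_invn : Clim (fun n => n%:R^-1) 0.
Proof.
apply: (@Clim_ext_loc 1 (fun n => RtoC (/ INR n))).
  by move=> n n0; rewrite natrC RtoC_inv //; apply: not_0_INR; lia.
split; last exact: is_lim_seq_const.
by have /= := is_lim_seq_inv _ _ is_lim_seq_INR; apply.
Qed.

(** Induction through (k+1) C(n,k+1) = (n-k) C(n,k), divided by n^(k+1). *)
Lemma Clim_bin k : Clim (fun n => 'C(n, k)%:R / n%:R ^+ k) (k`!%:R)^-1.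
Proof.
elim: k => [|k IH].
  apply: (@Clim_ext_loc 0 (fun=> (0`!%:R)^-1)); last exact: Clim_const.
  by move=> n _; rewrite bin0 fact0 expr0 divr1 invr1.
have k0 := @natrC_neq0 k.+1 isT.
have -> : ((k.+1)`!%:R)^-1 = (k`!%:R)^-1 * (1 - k%:R * 0) * k.+1%:R^-1 :> C.
  by rewrite mulr0 subr0 mulr1 factS natrM invfM mulrC.
apply: (@Clim_ext_loc k.+1 (fun n => 'C(n, k)%:R / n%:R ^+ k *
   (1 - k%:R * n%:R^-1) * k.+1%:R^-1)); last first.
  apply: ClimM; last exact: Clim_const.
  apply: ClimM => //; apply: ClimD; first exact: Clim_const.
  apply: ClimN; apply: ClimM; [exact: Clim_const|exact: Clim_invn].
move=> n kn; have n0 : (n%:R : C) != 0 by apply: natrC_neq0; lia.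
have := mul_bin_left n k => /(congr1 (fun x => x%:R : C)).
rewrite !natrM natrB; last by lia.
move=> e; apply: (mulfI k0); rewrite [RHS]mulrA e exprS.
move: k0; move: (k.+1%:R : C) => K1 K10; field.
by rewrite expf_neq0 // n0 K10.
Qed.

(* The limit of Newton's identities is again a recursion with rational
   coefficients in the single quantity 1/(1 - U). *)
Lemma inv_psum_lim N : exists r : nat -> {poly C},
  forall m, (0 < m <= N)%N ->
  (forall F : divringClosed C, r m \is a polyOver F) /\
  forall (M : nat -> nat) (w u : nat -> C) (U : C),
    (forall s, (s <= M s)%N) ->
    (forall s, (0 < s)%N -> (M s).-primitive_root (w s)) ->
    (forall s, (0 < s)%N -> u s ^+ M s = U) -> U != 1 ->
    Clim (fun s => inv_psum (M s) (w s) (u s) m / (M s)%:R ^+ m) (r m).[(1 - U)^-1].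
Proof.
elim: N => [|N [r rP]]; first by exists (fun=> 0) => m; lia.
(* After division by M^(N+1) the k-th term of the first sum carries M^-(N-k). Only k = N survives in
   the limit, which 0^(N-k) records, with 0^0 = 1. *)
pose c := \sum_(k < N.+1) (-1) ^+ k * ((k`!%:R)^-1 * 0 ^+ (N - k)) : C.
pose r' := 'X * (c%:P - \sum_(1 <= k < N.+1) ((-1) ^+ k / k`!%:R) *: r (N.+1 - k)%N).
exists (fun m => if m == N.+1 then r' else r m) => m /andP[m0].
rewrite leq_eqVlt ltnS => /predU1P[->|mN]; last first.
  by rewrite ltn_eqF ?ltnS //; apply: rP; rewrite m0.
rewrite eqxx; split.
  move=> F; rewrite rpredM ?polyOverX // rpredB //.
    rewrite polyOverC rpred_sum // => k _.
    by rewrite rpredM ?rpredX ?rpredN ?rpred1 // rpredM ?rpredV ?rpred_nat ?rpredX ?rpred0.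
  rewrite big_nat rpred_sum // => k kN; rewrite polyOverZ //.
    by rewrite rpredM ?rpredX ?rpredN ?rpred1 // rpredV rpred_nat.
  by apply: (proj1 (rP _ _)); lia.
move=> M w u U Ms wP uP U1.
have U1' : 1 - U != 0 by rewrite subr_eq0 eq_sym.
have -> : r'.[(1 - U)^-1] = (1 - U)^-1 * (c - \sum_(1 <= k < N.+1)
    (-1) ^+ k / k`!%:R * (r (N.+1 - k)%N).[(1 - U)^-1]).
  rewrite /r' !hornerE horner_sum; congr (_ * (_ - _)).
  by apply: eq_bigr => k _; rewrite hornerZ.
(* This is [inv_psum_rec] divided by M^(N+1); it is available once N + 1 <= s <= M s. *)
apply: (@Clim_ext_loc N.+1 (fun s => (1 - U)^-1 * (
  \sum_(k < N.+1) (-1) ^+ k * ('C(M s, k)%:R / (M s)%:R ^+ k * (M s)%:R^-1 ^+ (N - k))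
  - \sum_(1 <= k < N.+1) (-1) ^+ k * ('C(M s, k)%:R / (M s)%:R ^+ k) *
     (inv_psum (M s) (w s) (u s) (N.+1 - k) / (M s)%:R ^+ (N.+1 - k))))).
  move=> s Ns; have Ms0 : (0 < M s)%N by apply: leq_trans (Ms s); lia.
  have s0 : (0 < s)%N by lia.
  have M0 : ((M s)%:R : C) != 0 by apply: natrC_neq0.
  apply: (mulfI U1'); rewrite mulrA divff // mul1r [RHS]mulrA.
  rewrite (inv_psum_rec (wP s s0) (uP s s0) U1); last by have := Ms s; lia.
  rewrite mulrBl; congr (_ - _).
    rewrite mulr_sumr mulr_suml; apply: eq_bigr => k _.
    have kN : (k <= N)%N by rewrite -ltnS.
    have -> : (M s)%:R ^+ N.+1 = (M s)%:R * ((M s)%:R ^+ k * (M s)%:R ^+ (N - k)) :> C.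
      by rewrite -exprD subnKC // exprS.
    by rewrite exprVn; field; rewrite !expf_neq0.
  rewrite mulr_suml !big_nat; apply: eq_bigr => k kN.
  have kN' : (k <= N.+1)%N by lia.
  have -> : (M s)%:R ^+ N.+1 = (M s)%:R ^+ k * (M s)%:R ^+ (N.+1 - k) :> C.
    by rewrite -exprD subnKC.
  by field; rewrite !expf_neq0.
apply: ClimM; first exact: Clim_const.
have binM k := @Clim_comp _ _ M Ms (Clim_bin k).
apply: ClimD.
  apply: Clim_sum => k _; apply: ClimM; first exact: Clim_const.
  apply: ClimM; first exact: binM.
  by apply: ClimX; apply: (@Clim_comp _ _ M Ms Clim_invn).
apply: ClimN; rewrite big_nat.
apply: (@Clim_ext_loc 0 (fun s => \sum_(1 <= k < N.+1 | (1 <= k < N.+1)%N)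
  (-1) ^+ k * ('C(M s, k)%:R / (M s)%:R ^+ k) *
     (inv_psum (M s) (w s) (u s) (N.+1 - k) / (M s)%:R ^+ (N.+1 - k)))).
  by move=> s _; rewrite -big_nat.
apply: Clim_sum => k kN; apply: ClimM.
  by apply: ClimM; [exact: Clim_const|exact: binM].
by apply: (proj2 (rP _ _)); first lia.
Qed.

End CyclotomicPowerSums.

Module OddLValues.

Import all_boot all_order all_algebra all_field all_solvable.
Import boolp Rstruct complex zify.
Import CyclotomicPowerSums.
Set Implicit Arguments. Unset Strict Implicit. Unset Printing Implicit Defensive.
Import GRing.Theory.
Delimit Scope R_scope with Re.
Delimit Scope C_scope with C.
Delimit Scope Z_scope with ZZ.
Local Open Scope ring_scope.

(** * Tannery's theorem *)

Lemma sum_nE (f : nat -> C) n : sum_n f n = \sum_(i < n.+1) f i.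
Proof.
elim: n => [|n IH]; first by rewrite sum_O big_ord1.
by rewrite sum_Sn IH [RHS]big_ord_recr.
Qed.

Lemma fst_sum_n (f : nat -> C) n : fst (sum_n f n) = sum_n (fun i => fst (f i)) n.
Proof.
elim: n => [|n IH]; first by rewrite !sum_O.
by rewrite !sum_Sn -IH.
Qed.

Lemma snd_sum_n (f : nat -> C) n : snd (sum_n f n) = sum_n (fun i => snd (f i)) n.
Proof.
elim: n => [|n IH]; first by rewrite !sum_O.
by rewrite !sum_Sn -IH.
Qed.

Lemma is_series_Clim (f : nat -> C) (v : C) : is_series f v -> Clim (sum_n f) v.
Proof.
move=> fv; split=> P [eps Pe].
- apply: (fv (fun z => P (fst z))); exists eps => y [y1 y2].
  exact: Pe.
- apply: (fv (fun z => P (snd z))); exists eps => y [y1 y2].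
  exact: Pe.
Qed.

(** Three errors of size eps/3: the dominated tail beyond [n0], the tail of the limit series, and
    the finite part up to [n0] for large s. *)
Lemma tannery_R (a : nat -> nat -> R) (l B : nat -> R) (h : nat -> nat) (S : R) :
  (forall s n, (Rabs (a s n) <= B n)%Re) -> ex_series B ->
  (forall n, is_lim_seq (fun s => a s n) (l n)) ->
  (forall s, (s <= h s)%N) -> is_series l S ->
  is_lim_seq (fun s => sum_n (a s) (h s)) S.
Proof.
move=> aB exB al hs lS.
apply/is_lim_seq_spec => eps.
have e3 : (0 < eps / 3)%Re by have := cond_pos eps; lra.
have [N1 HN1] := Cauchy_ex_series _ exB (mkposreal _ e3).
have /is_lim_seq_spec lS' : is_lim_seq (sum_n l) S by [].
have [N2 HN2] := lS' (mkposreal _ e3).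
pose n0 := maxn N1 N2.
have fin : is_lim_seq (fun s => sum_n (a s) n0) (sum_n l n0).
  elim: n0 => [|n IH].
    by rewrite sum_O; apply: is_lim_seq_ext (al 0%N) => s; rewrite sum_O.
  rewrite sum_Sn; apply: (is_lim_seq_ext (fun s => (sum_n (a s) n + a s n.+1)%Re)).
    by move=> s; rewrite sum_Sn.
  exact: is_lim_seq_plus'.
have [N3 HN3] := (proj2 (is_lim_seq_spec _ _) fin) (mkposreal _ e3).
exists (maxn N3 n0.+1) => s /leP sN.
have n0h : (n0 < h s)%N by apply: leq_trans (hs s); lia.
have /= H3 := HN3 s ltac:(lia).
have /= H2 := HN2 n0 ltac:(lia).
have /= H1 := HN1 n0.+1 (h s) ltac:(lia) ltac:(lia).
have E : sum_n (a s) (h s) = (sum_n (a s) n0 + sum_n_m (a s) n0.+1 (h s))%Re.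
  rewrite /sum_n (sum_n_m_Chasles _ 0 n0) //; lia.
have T : (Rabs (sum_n_m (a s) n0.+1 (h s)) <= sum_n_m B n0.+1 (h s))%Re.
  apply: Rle_trans (norm_sum_n_m (V := R_NormedModule) _ _ _) _.
  by apply: sum_n_m_le => k; apply: aB.
have B1 : (sum_n_m B n0.+1 (h s) < eps / 3)%Re.
  by apply: Rle_lt_trans H1; apply: Rle_abs.
rewrite E.
move: H3 H2 T; rewrite /Rabs; do !case: Rcase_abs => ?; lra.
Qed.

Lemma tannery (a : nat -> nat -> C) (l : nat -> C) (B : nat -> R)
    (h : nat -> nat) (S : C) :
  (forall s n, (n < h s)%N -> (Cmod (a s n) <= B n)%Re) ->
  ex_series B -> (forall n, (0 <= B n)%Re) ->
  (forall n, Clim (fun s => a s n) (l n)) ->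
  (forall s, (s <= (h s).+1)%N) -> Clim (sum_n l) S ->
  Clim (fun s => \sum_(n < h s) a s n) S.
Proof.
move=> aB exB B0 al hs [S1 S2].
pose b s n := if (n < h s)%N then a s n else 0.
have bl n : Clim (fun s => b s n) (l n).
  apply: (@Clim_ext_loc n.+2 (fun s => a s n)); last exact: al.
  by move=> s ns; rewrite /b ifT //; have := hs s; lia.
have bB s n : (Cmod (b s n) <= B n)%Re.
  by rewrite /b; case: ifP => [|_]; [apply: aB|rewrite Cmod_0].
have sumE s : sum_n (b s) (h s) = \sum_(n < h s) a s n.
  rewrite sum_nE big_ord_recr /= /b ltnn addr0; apply: eq_bigr => i _.
  by rewrite ltn_ord.
(* [tannery_R] includes its last index and wants it to be at least s. The terms of [b] from [h s] on
   are 0, so raising the index to the maximum changes nothing. *)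
have hs1 s : (s <= maxn s (h s))%N by apply: leq_maxl.
have sumE' s : sum_n (b s) (maxn s (h s)) = \sum_(n < h s) a s n.
  have := hs s; rewrite leq_eqVlt => /predU1P[e|sh]; last first.
    by rewrite (maxn_idPr _).
  have -> : maxn s (h s) = (h s).+1 by rewrite {1}e; apply/maxn_idPl.
  by rewrite sum_Sn sumE /b ltnNge leqnSn /=; apply: addr0.
split.
- apply: is_lim_seq_ext; last first.
    apply: (@tannery_R (fun s n => fst (b s n)) (fun n => fst (l n)) B
       (fun s => maxn s (h s))) => //.
    + by move=> s n; apply: Rle_trans (bB s n); apply: re_le_Cmod.
    + by move=> n; case: (bl n).
    + by apply: is_lim_seq_ext S1 => n; rewrite fst_sum_n.
  by move=> s /=; rewrite -fst_sum_n sumE'.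
- apply: is_lim_seq_ext; last first.
    apply: (@tannery_R (fun s n => snd (b s n)) (fun n => snd (l n)) B
       (fun s => maxn s (h s))) => //.
    + move=> s n; apply: Rle_trans (bB s n); apply: Rle_trans (Rmax_Cmod _).
      exact: Rmax_r.
    + by move=> n; case: (bl n).
    + by apply: is_lim_seq_ext S2 => n; rewrite snd_sum_n.
  by move=> s /=; rewrite -snd_sum_n sumE'.
Qed.

Lemma is_series_inv_mul_succ :
  is_series (fun n => / (INR n.+1 * INR n.+2))%Re 1%Re.
Proof.
have E n : sum_n (fun n => / (INR n.+1 * INR n.+2))%Re n = (1 - / INR n.+2)%Re.
  elim: n => [|n IH]; first by rewrite sum_O; change (/ (1 * (1 + 1)) = 1 - / (1 + 1))%Re; field.
  rewrite sum_Sn IH.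
  have := pos_INR n; rewrite !S_INR => ?.
  change ((1 - / (INR n + 1 + 1) + / ((INR n + 1 + 1) * (INR n + 1 + 1 + 1)) =
    1 - / (INR n + 1 + 1 + 1))%Re); field; lra.
suff : is_lim_seq (sum_n (fun n => / (INR n.+1 * INR n.+2))%Re) 1%Re by [].
apply: (is_lim_seq_ext (fun n => (1 - / INR n.+2)%Re)) => [n|]; first by rewrite E.
have := @is_lim_seq_minus' (fun=> 1%Re) (fun n => / INR n.+2)%Re 1%Re 0%Re.
rewrite Rminus_0_r; apply; first exact: is_lim_seq_const.
have h : is_lim_seq (fun n => / INR n)%Re 0%Re.
  by have /= := is_lim_seq_inv _ _ is_lim_seq_INR; apply.
by apply: (proj1 (is_lim_seq_incr_1 (fun n => / INR n.+1)%Re _));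
   apply: (proj1 (is_lim_seq_incr_1 (fun n => / INR n)%Re _)).
Qed.

Lemma ex_series_inv_sqr : ex_series (fun n => / INR n.+1 ^ 2)%Re.
Proof.
apply: (ex_series_le _ (fun n => 2 * / (INR n.+1 * INR n.+2))%Re); last first.
  by exists (2 * 1)%Re; apply: (is_series_scal 2%Re); apply: is_series_inv_mul_succ.
move=> n; rewrite /norm /= /abs /=.
have n0 := pos_INR n.
rewrite -!/(INR n.+1) !S_INR.
rewrite Rabs_right; last by apply/Rle_ge/Rlt_le/Rinv_0_lt_compat; nra.
apply: (Rmult_le_reg_r ((INR n + 1) * (INR n + 1) * (INR n + 1 + 1))%Re); first nra.
field_simplify; nra.
Qed.

(** * The roots of unity zeta *)

Lemma zetaX n j :
  zeta n ^+ j = (cos (2 * PI / INR n * INR j), sin (2 * PI / INR n * INR j))%Re.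
Proof.
elim: j => [|j IH]; first by rewrite expr0 /= Rmult_0_r cos_0 sin_0.
rewrite exprS IH S_INR Rmult_plus_distr_l Rmult_1_r Rplus_comm cos_plus sin_plus.
rewrite Rplus_comm /zeta; set a := (_ / _)%Re; set b := (_ * _)%Re.
exact: (erefl (Cmult (cos a, sin a) (cos b, sin b))).
Qed.

Lemma Cmod_zetaX n j : Cmod (zeta n ^+ j) = 1%Re.
Proof.
rewrite zetaX /Cmod /=; set t := (_ * INR j)%Re.
have := sin2_cos2 t; rewrite /Rsqr => h.
by rewrite (_ : (_ + _)%Re = 1%Re) ?sqrt_1 //; lra.
Qed.

Lemma INR_gt0 n : (0 < n)%N -> (0 < INR n)%Re.
Proof. by move=> n0; apply: lt_0_INR; apply/ltP. Qed.

Lemma zeta_expn n : (0 < n)%N -> zeta n ^+ n = 1.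
Proof.
move=> n0; have n0' := INR_gt0 n0; rewrite zetaX.
rewrite (_ : (_ * INR n)%Re = (2 * PI)%Re); last by field; lra.
by rewrite cos_2PI sin_2PI.
Qed.

(** For 0 < m < n, cos(2 pi m/n) = 1 - 2 sin^2(pi m/n) < 1, so no smaller power of [zeta n] is 1. *)
Lemma zeta_prim n : (0 < n)%N -> n.-primitive_root (zeta n).
Proof.
move=> n0; have [m mP mn] := prim_order_exists n0 (zeta_expn n0).
have m0 := prim_order_gt0 mP.
suff e : m = n by rewrite e in mP.
apply/eqP; rewrite eqn_leq dvdn_leq //= leqNgt; apply/negP => mltn.
have := prim_expr_order mP; rewrite zetaX => -[+ _].
have n0' := INR_gt0 n0; have m0' := INR_gt0 m0.
have mn' : (INR m < INR n)%Re by apply: lt_INR; apply/ltP.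
have P0 := PI_RGT_0.
rewrite (_ : (_ * INR m)%Re = (2 * (PI * (INR m / INR n)))%Re); last by field; lra.
have r0 : (0 < INR m / INR n)%Re by apply: Rdiv_lt_0_compat.
have r1 : (INR m / INR n < 1)%Re.
  apply: (Rmult_lt_reg_r (INR n)) => //; field_simplify; lra.
have := @sin_gt_0 (PI * (INR m / INR n))%Re ltac:(nra) ltac:(nra).
rewrite cos_2a_sin /=; nra.
Qed.

Lemma zeta_mulX n m : (0 < n)%N -> (0 < m)%N -> zeta (n * m) ^+ m = zeta n.
Proof.
move=> n0 m0; have n0' := INR_gt0 n0; have m0' := INR_gt0 m0.
rewrite zetaX /zeta mult_INR.
by rewrite (_ : (_ * INR m)%Re = (2 * PI / INR n)%Re) //; field; lra.
Qed.

(** From sin x >= x - x^3/6 and x <= 2. *)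
Lemma sin_ge_third x : (0 <= x <= PI / 2)%Re -> (x / 3 <= sin x)%Re.
Proof.
move=> [x0 x1]; have P4 := PI_4; have P0 := PI_RGT_0.
have [h _] := @sin_bound x 0 x0 ltac:(lra).
apply: Rle_trans h; rewrite /sin_approx /sin_term /=.
have x2 : (x <= 2)%Re by lra.
have : (x ^ 3 <= 4 * x)%Re by nra.
rewrite /=; lra.
Qed.

(** With x = pi n/N <= pi/2 the modulus is 2 sin x >= 2x/3, and pi > 2. *)
Lemma Cmod_1zetaX_ge N n : (2 * n <= N)%N -> (0 < N)%N ->
  (INR n / INR N <= Cmod (1 - zeta N ^+ n)%R)%Re.
Proof.
move=> nN N0; have N0' := INR_gt0 N0; have n0' := pos_INR n.
have nN' : (2 * INR n <= INR N)%Re.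
  by have := le_INR _ _ (elimT leP nN); rewrite mult_INR /=.
set x := (PI * (INR n / INR N))%Re.
have r0 : (0 <= INR n / INR N)%Re by apply: Rdiv_le_0_compat.
have r1 : (INR n / INR N <= / 2)%Re.
  apply: (Rmult_le_reg_r (INR N)) => //; field_simplify; lra.
have P0 := PI_RGT_0; have P2 := PI2_1.
have sx := @sin_ge_third x ltac:(split; rewrite /x; nra).
have -> : Cmod (1 - zeta N ^+ n) = (2 * sin x)%Re.
  rewrite zetaX (_ : (2 * PI / INR N * INR n)%Re = (2 * x)%Re); last first.
    by rewrite /x; field; lra.
  rewrite -[LHS]/(sqrt ((1 + - cos (2 * x)) ^ 2 + (0 + - sin (2 * x)) ^ 2))%Re.
  rewrite (_ : (_ + _)%Re = ((2 * sin x) ^ 2)%Re); last first.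
    rewrite cos_2a_sin sin_2a; have := sin2_cos2 x; rewrite /Rsqr => e.
    have -> : ((1 + - (1 - 2 * sin x * sin x)) ^ 2 + (0 + - (2 * sin x * cos x)) ^ 2 =
      (2 * sin x) ^ 2 * (sin x * sin x + cos x * cos x))%Re by ring.
    by rewrite e Rmult_1_r.
  by rewrite sqrt_pow2 //; move: sx; rewrite /x; nra.
by move: sx; rewrite {1}/x; nra.
Qed.

Lemma Cmod_inv_1zetaX_le N n : (2 * n <= N)%N -> (0 < n)%N ->
  (Cmod (1 - zeta N ^+ n)^-1%R <= INR N / INR n)%Re.
Proof.
move=> nN n0; have N0 : (0 < N)%N by lia.
have h := Cmod_1zetaX_ge nN N0.
have N0' := INR_gt0 N0; have n0' := INR_gt0 n0.
have r0 : (0 < INR n / INR N)%Re by apply: Rdiv_lt_0_compat.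
have nz : (1 - zeta N ^+ n)%R <> 0%C.
  by move=> e; move: h; rewrite e Cmod_0; lra.
rewrite -[X in Cmod X]/(Cinv (1 - zeta N ^+ n)%R) Cmod_inv //.
rewrite (_ : (INR N / INR n)%Re = (/ (INR n / INR N))%Re); last by field; lra.
exact: Rinv_le_contravar.
Qed.

Lemma derivable_lim_seq (g : R -> R) (d : R) : is_derive g 0%Re d ->
  is_lim_seq (fun s => INR s * (g (/ INR s) - g 0))%Re d.
Proof.
move=> /is_derive_Reals dg; apply/is_lim_seq_spec => eps.
have [del H] := dg eps (cond_pos eps).
have [N HN] : eventually (fun s => (/ INR s < del)%Re).
  have /is_lim_seq_spec h : is_lim_seq (fun n => / INR n)%Re 0%Re.
    by have /= := is_lim_seq_inv _ _ is_lim_seq_INR; apply.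
  have [N HN] := h del; exists N => n /HN; rewrite Rminus_0_r => a.
  by apply: Rle_lt_trans a; apply: Rle_abs.
exists (maxn N 1) => s /leP sN.
have s0 : (0 < INR s)%Re by apply: INR_gt0; lia.
have i0 : (0 < / INR s)%Re by apply: Rinv_0_lt_compat.
have := H (/ INR s)%Re ltac:(lra) ltac:(rewrite Rabs_right; [apply: HN; lia|lra]).
rewrite Rplus_0_l (_ : (_ / / INR s)%Re = (INR s * (g (/ INR s) - g 0))%Re) //.
by field; lra.
Qed.

(** This is -2 pi i, the derivative at 0 of x -> 1 - exp(2 pi i x). *)
Definition tau : C := (0, - (2 * PI))%Re.

Lemma tau_neq0 : tau != 0.
Proof. by apply/eqP => -[]; have := PI_RGT_0; lra. Qed.

Lemma Clim_1zetaX q n : (0 < q)%N ->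
  Clim (fun s => (1 - zeta (2 * (q * s)) ^+ n) * (2 * s)%:R) (n%:R * (tau / q%:R)).
Proof.
move=> q0; have q0' := INR_gt0 q0.
pose c := (PI * INR n / INR q)%Re.
have -> : n%:R * (tau / q%:R) = (0, - (2 * c))%Re :> C.
  rewrite !natrC -[_ / _]/(Cdiv tau (INR q)) /Cdiv -RtoC_inv; last by lra.
  rewrite -[_ * _]/(Cmult (INR n) (Cmult tau (/ INR q)%Re)) /Cmult /tau /RtoC /c /=.
  by congr pair; field; lra.
have E s : (0 < s)%N -> (1 - zeta (2 * (q * s)) ^+ n) * (2 * s)%:R =
    (2 * (INR s * (1 - cos (c * / INR s))), - (2 * (INR s * sin (c * / INR s))))%Re.
  move=> s0; have s0' := INR_gt0 s0.
  rewrite zetaX natrC !mult_INR (_ : INR 2 = 2%Re) //.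
  rewrite (_ : (_ * INR n)%Re = (c * / INR s)%Re); last first.
    by rewrite /c; field; lra.
  rewrite -[LHS]/(Cmult (Cminus 1 (cos (c * / INR s), sin (c * / INR s))) (2 * INR s)%Re).
  rewrite /Cmult /Cminus /Cplus /Copp /RtoC /=.
  by congr pair; ring.
split.
- apply: (is_lim_seq_ext_loc (fun s => (- 2) * (INR s * (cos (c * / INR s) - cos (c * 0))))%Re).
    exists 1%N => s /leP s0; rewrite E //= Rmult_0_r cos_0; lra.
  have -> : Rbar.Finite (fst (0, - (2 * c))%Re) = Rbar_mult (-2)%Re 0%Re.
    by rewrite /= Rmult_0_r.
  apply: is_lim_seq_scal_l; apply: (derivable_lim_seq (g := fun x => cos (c * x))).
  by auto_derive => //; rewrite Rmult_0_r sin_0; ring.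
- apply: (is_lim_seq_ext_loc (fun s => (- 2) * (INR s * (sin (c * / INR s) - sin (c * 0))))%Re).
    exists 1%N => s /leP s0; rewrite E //= Rmult_0_r sin_0; lra.
  have -> : Rbar.Finite (snd (0, - (2 * c))%Re) = Rbar_mult (-2)%Re c.
    by rewrite /=; congr Rbar.Finite; ring.
  apply: is_lim_seq_scal_l; apply: (derivable_lim_seq (g := fun x => sin (c * x))).
  by auto_derive => //; rewrite Rmult_0_r cos_0; ring.
Qed.

Lemma Clim_inv_1zetaX q n : (0 < q)%N -> (0 < n)%N ->
  Clim (fun s => (1 - zeta (2 * (q * s)) ^+ n)^-1 / (2 * s)%:R) (q%:R / tau / n%:R).
Proof.
move=> q0 n0; have l0 : n%:R * (tau / q%:R) != 0.
  by rewrite !mulf_neq0 ?invr_eq0 ?natrC_neq0 ?tau_neq0.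
have -> : q%:R / tau / n%:R = (n%:R * (tau / q%:R))^-1 :> C.
  by rewrite !invfM invrK mulrC [q%:R * _]mulrC.
apply: (@Clim_ext_loc 0 (fun s => ((1 - zeta (2 * (q * s)) ^+ n) * (2 * s)%:R)^-1)).
  by move=> s _; rewrite invfM.
by apply: ClimV => //; apply: Clim_1zetaX.
Qed.

(** * Values of odd periodic series *)

Lemma RtoCX (x : R) m : RtoC (x ^ m)%Re = RtoC x ^+ m.
Proof. by elim: m => [|m IH] //=; rewrite RtoC_mult IH exprS. Qed.

Lemma CmodX (x : C) m : Cmod (x ^+ m) = (Cmod x ^ m)%Re.
Proof.
elim: m => [|m IH]; first by rewrite expr0 -[1%R]/(RtoC 1) Cmod_1.
by rewrite exprS -[x * _]/(Cmult x (x ^+ m)) Cmod_mult IH.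
Qed.

(** With H = h + 1, the index n is paired with 2H - n; 0 and the midpoint H stay alone. *)
Lemma sum_fold_half (g : nat -> C) h :
  \sum_(n < 2 * h.+1) g n =
  g 0%N + g h.+1 + \sum_(n < h) (g n.+1 + g (2 * h.+1 - n.+1)%N).
Proof.
rewrite -(big_mkord xpredT) mul2n -addnn.
rewrite (big_cat_nat (n := h.+1)) ?leq_addr //=.
rewrite -{2}[h.+1]add0n big_addn addnK !big_mkord.
rewrite [in X in _ + X](reindex_inj rev_ord_inj) /=.
rewrite big_ord_recl [X in _ + X]big_ord_recr /= big_split /= !subSS subnn add0n.
rewrite [RHS](AC (2*2) (1*3*(4*2)))%AC; congr (_ + _ + (_ + _)).
by apply: eq_bigr => i _; congr g; have := ltn_ord i; lia.
Qed.

Lemma sum_regroup (g : nat -> C) q M :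
  \sum_(n < q * M) g n = \sum_(b < q) \sum_(j < M) g (b + q * j)%N.
Proof.
rewrite exchange_big /=; elim: M => [|M IH]; first by rewrite muln0 !big_ord0.
rewrite big_ord_recr /= -IH mulnS addnC big_split_ord /=; congr (_ + _).
by apply: eq_bigr => i _; rewrite addnC.
Qed.

Section OddPeriodicSeries.

Variables (q m : nat) (f : nat -> C) (v : C).
Hypotheses (q_gt1 : (1 < q)%N) (m_odd : odd m) (m_gt1 : (1 < m)%N).
Hypothesis f0 : f 0%N = 0.
Hypothesis f_per : forall b j, f (b + q * j)%N = f b.
Hypothesis f_odd : forall k n, (n <= k * q)%N -> f (k * q - n)%N = - f n.
Hypothesis f_le1 : forall n, (Cmod (f n) <= 1)%Re.
Hypothesis f_series : is_series (fun n => f n.+1 / n.+1%:R ^+ m) v.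

Let q_gt0 : (0 < q)%N := ltnW q_gt1.

(** The order 2qs has its midpoint qs at a multiple of q, where f vanishes. Folding there keeps n
    below half the order, the range in which |1/(1 - z^n)| <= 2qs/n. *)
Let z s := zeta (2 * (q * s)).
Let y s n := (1 - z s ^+ n)^-1.

Let z_expn s : (0 < s)%N -> z s ^+ (2 * (q * s)) = 1.
Proof. by move=> s0; rewrite zeta_expn // !muln_gt0 q_gt0 s0. Qed.

Let z_neq1 s n : (0 < s)%N -> (0 < n < 2 * (q * s))%N -> 1 - z s ^+ n != 0.
Proof.
move=> s0 n0; rewrite subr_eq0 eq_sym -(prim_order_dvd (zeta_prim _)).
  by rewrite gtnNdvd //; lia.
by rewrite !muln_gt0 q_gt0 s0.
Qed.

Let y_refl s n : (0 < s)%N -> (0 < n < 2 * (q * s))%N ->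
  y s (2 * (q * s) - n) = 1 - y s n.
Proof.
move=> s0 /andP[n0 nN].
have d : 1 - z s ^+ n != 0 by rewrite z_neq1 ?n0.
have zn0 : z s ^+ n != 0.
  rewrite expf_neq0 //; apply/eqP => z0; move/eqP: (z_expn s0).
  by rewrite z0 expr0n gtn_eqF ?(eq_sym 0) ?oner_eq0 // !muln_gt0 q_gt0.
have E : z s ^+ (2 * (q * s) - n) = (z s ^+ n)^-1.
  by apply: (mulIf zn0); rewrite -exprD subnK ?(ltnW nN) // z_expn // mulVf.
by rewrite /y E inv_1subV.
Qed.

(** The joint contribution of n + 1 and 2qs - (n + 1): f changes sign and y becomes 1 - y. *)
Let term s n := f n.+1 * (y s n.+1 ^+ m - (1 - y s n.+1) ^+ m) / (2 * s)%:R ^+ m.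

Let sum_termE s : (0 < s)%N ->
  (\sum_(n < 2 * (q * s)) f n * y s n ^+ m) / (2 * s)%:R ^+ m =
  \sum_(n < (q * s).-1) term s n.
Proof.
move=> s0; have qs0 : (0 < q * s)%N by rewrite muln_gt0 q_gt0.
have := sum_fold_half (fun n => f n * y s n ^+ m) (q * s).-1.
have fqs : f (q * s)%N = 0 by rewrite -[(q * s)%N]add0n f_per.
rewrite prednK // f0 fqs !mul0r !add0r => ->.
rewrite mulr_suml.
apply: eq_bigr => n _; have nN := ltn_ord n.
rewrite y_refl //; last by lia.
rewrite (_ : 2 * (q * s) - n.+1 = (2 * s) * q - n.+1)%N; last by lia.
by rewrite f_odd; [rewrite mulNr -mulrBr|lia].
Qed.

(** y/(2s) tends to a and 1/(2s) to 0, so (1 - y)/(2s) tends to -a. As m is odd, the two m-th powers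
    add up, whence the factor 2. *)
Let term_lim n :
  Clim (fun s => term s n) (2 * (q%:R / tau) ^+ m * (f n.+1 / n.+1%:R ^+ m)).
Proof.
have L := @Clim_inv_1zetaX q n.+1 q_gt0 isT.
have M0 : Clim (fun s => (2 * s)%:R^-1) 0.
  by apply: (@Clim_comp _ _ (fun s => 2 * s)%N _ Clim_invn) => s; lia.
pose a := q%:R / tau / n.+1%:R.
have -> : 2 * (q%:R / tau) ^+ m * (f n.+1 / n.+1%:R ^+ m) =
    f n.+1 * (a ^+ m - (0 - a) ^+ m) :> C.
  rewrite sub0r exprNn -signr_odd m_odd expr1 mulN1r opprK -mulr2n -[in RHS]mulr_natl.
  by rewrite /a [in RHS]expr_div_n mulrACA [RHS]mulrCA -[LHS]mulrA.
apply: (@Clim_ext_loc 0 (fun s => f n.+1 * ((y s n.+1 / (2 * s)%:R) ^+ m -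
   ((2 * s)%:R^-1 - y s n.+1 / (2 * s)%:R) ^+ m))).
  move=> s _; rewrite /term -mulrA mulrBl; congr (_ * (_ - _)).
    by rewrite expr_div_n.
  by rewrite -expr_div_n mulrBl mul1r.
apply: ClimM; first exact: Clim_const.
apply: ClimD; first exact: ClimX.
by apply: ClimN; apply: ClimX; apply: ClimD => //; apply: ClimN.
Qed.

Lemma odd_series_lim :
  Clim (fun s => (\sum_(n < 2 * (q * s)) f n * y s n ^+ m) / (2 * s)%:R ^+ m)
    (2 * (q%:R / tau) ^+ m * v).
Proof.
apply: (@Clim_ext_loc 1 (fun s => \sum_(n < (q * s).-1) term s n)).
  by move=> s s0; rewrite sum_termE.
(* Both y/(2s) and (1 - y)/(2s) have modulus at most q/(n+1); since m >= 2, their m-th powers are at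
   most q^m/(n+1)^2. *)
pose B n := (2 * INR q ^ m * / INR n.+1 ^ 2)%Re.
have q0 := INR_gt0 q_gt0.
apply: (@tannery term _ B (fun s => (q * s).-1)).
- move=> s n nh; have s0 : (0 < s)%N by case: (s) nh => //; rewrite muln0.
  have s0' := INR_gt0 s0.
  have n0 := pos_INR n.
  have n1 : (1 <= INR n.+1)%Re by rewrite S_INR; lra.
  (* This gives |1 - y| = |y|, since powers of z have modulus 1. *)
  have yE : 1 - y s n.+1 = - (z s ^+ n.+1 * y s n.+1).
    have d := @z_neq1 s n.+1 s0 ltac:(lia).
    apply: (mulIf d); rewrite mulNr -mulrA !mulVf // mulr1 mulrBl mulVf // mul1r.
    by rewrite addrAC subrr add0r.
  have yb : (Cmod (y s n.+1 / (2 * s)%:R)%R <= INR q / INR n.+1)%Re.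
    have h := @Cmod_inv_1zetaX_le (2 * (q * s)) n.+1 ltac:(lia) isT.
    rewrite natrC -[_ / _]/(Cmult (y s n.+1) (Cinv (INR (2 * s)))) Cmod_mult.
    have s2 : (INR (2 * s) = 2 * INR s)%Re by rewrite mult_INR.
    rewrite -RtoC_inv ?s2; last lra.
    rewrite Cmod_R Rabs_right; last by apply/Rle_ge/Rlt_le/Rinv_0_lt_compat; lra.
    move: h; rewrite !mult_INR (_ : INR 2 = 2%Re) // => h.
    rewrite (_ : (INR q / INR n.+1)%Re = (2 * (INR q * INR s) / INR n.+1 * / (2 * INR s))%Re).
      by apply: Rmult_le_compat_r => //; apply/Rlt_le/Rinv_0_lt_compat; lra.
    by field; lra.
  have yb' : (Cmod ((1 - y s n.+1) / (2 * s)%:R)%R <= INR q / INR n.+1)%Re.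
    rewrite yE mulNr -mulrA.
    rewrite -[X in Cmod X]/(Copp (Cmult (z s ^+ n.+1) (y s n.+1 / (2 * s)%:R)%R)).
    by rewrite Cmod_opp Cmod_mult Cmod_zetaX Rmult_1_l.
  have tE : term s n = f n.+1 * ((y s n.+1 / (2 * s)%:R) ^+ m -
      ((1 - y s n.+1) / (2 * s)%:R) ^+ m).
    by rewrite /term -mulrA mulrBl !expr_div_n.
  have pb : ((INR q / INR n.+1) ^ m <= INR q ^ m * / INR n.+1 ^ 2)%Re.
    rewrite /Rdiv Rpow_mult_distr pow_inv; apply: Rmult_le_compat_l.
      by apply: pow_le; lra.
    apply: Rinv_le_contravar; first by apply: pow_lt; lra.
    by apply: Rle_pow => //; apply/leP.
  rewrite tE -[X in Cmod X]/(Cmult (f n.+1) (Cminus ((y s n.+1 / (2 * s)%:R) ^+ m)%R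
      (((1 - y s n.+1) / (2 * s)%:R) ^+ m)%R)) Cmod_mult.
  have tb : (Cmod (Cminus ((y s n.+1 / (2 * s)%:R) ^+ m)%R
      (((1 - y s n.+1) / (2 * s)%:R) ^+ m)%R) <= B n)%Re.
    apply: Rle_trans (Cmod_triangle _ _) _; rewrite Cmod_opp !CmodX.
    have h1 := pow_incr _ _ m (conj (Cmod_ge_0 _) yb).
    have h2 := pow_incr _ _ m (conj (Cmod_ge_0 _) yb').
    rewrite /B; lra.
  have := f_le1 n.+1; have := Cmod_ge_0 (f n.+1).
  move: tb; set X := Cmod (Cminus _ _); have : (0 <= X)%Re by apply: Cmod_ge_0.
  by move: X (B n) (Cmod _) => X b c; nra.
- by apply: (ex_series_scal (2 * INR q ^ m)%Re); apply: ex_series_inv_sqr.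
- move=> n; rewrite /B; apply: Rmult_le_pos.
    by apply: Rmult_le_pos; [lra|apply: pow_le; lra].
  by apply/Rlt_le/Rinv_0_lt_compat/pow_lt/INR_gt0.
- exact: term_lim.
- move=> s; case: s => // s; rewrite prednK ?muln_gt0 ?q_gt0 //.
  by rewrite leq_pmull.
- apply: (@Clim_ext_loc 0 (fun n => 2 * (q%:R / tau) ^+ m *
     sum_n (fun n => f n.+1 / n.+1%:R ^+ m) n)).
    by move=> n _; rewrite !sum_nE mulr_sumr.
  by apply: ClimM; [exact: Clim_const|exact: is_series_Clim].
Qed.

End OddPeriodicSeries.

(* Both sides are limits of the same finite sums over the (2qs)-th roots of
   unity: one grouped by residue class mod q, the other evaluated termwise. *)
Lemma odd_series_value (q m : nat) : (1 < q)%N -> odd m -> (1 < m)%N ->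
  exists S : {poly C}, (forall F : divringClosed C, S \is a polyOver F) /\
  forall (f : nat -> C) (v : C), f 0%N = 0 ->
    (forall b j, f (b + q * j)%N = f b) ->
    (forall k n, (n <= k * q)%N -> f (k * q - n)%N = - f n) ->
    (forall n, (Cmod (f n) <= 1)%Re) ->
    is_series (fun n => f n.+1 / n.+1%:R ^+ m) v ->
    v = (tau ^+ m / 2) * \sum_(b < q) f b * S.[zeta q ^+ b].
Proof.
move=> q1 mo m1; have [r rP] := inv_psum_lim m.
have q0 : (0 < q)%N by lia.
have [rF rl] := rP m ltac:(lia).
have qn0 : (q%:R : C) != 0 by apply: natrC_neq0.
have n20 : (2%:R : C) != 0 by apply: natrC_neq0.
(* By [sum_mul_expr], Y takes the value 1/(1 - x) at every q-th root of unity x other than 1. *)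
pose Y : {poly C} := (- q%:R^-1) *: \sum_(j < q) j%:R *: 'X^j.
(* The factor q^-m absorbs the q^m of [odd_series_lim]; the remaining constant tau^m/2 is then the
   same for all moduli. *)
exists ((q%:R ^- m) *: (r m \Po Y)); split.
  move=> F; have YF : Y \is a polyOver F.
    rewrite polyOverZ ?rpredN ?rpredV ?rpred_nat // rpred_sum // => j _.
    by rewrite polyOverZ ?rpred_nat ?polyOverXn.
  rewrite polyOverZ ?rpredV ?rpredX ?rpred_nat //.
  by rewrite polyOver_comp ?rF.
move=> f v f0 fper fodd fle fs.
have Yz b : (0 < b < q)%N -> Y.[zeta q ^+ b] = (1 - zeta q ^+ b)^-1.
  move=> bq; have z1 : zeta q ^+ b != 1.
    by rewrite -(prim_order_dvd (zeta_prim q0)) gtnNdvd //; lia.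
  have zq : (zeta q ^+ b) ^+ q = 1 by rewrite exprAC zeta_expn // expr1n.
  have z1' : 1 - zeta q ^+ b != 0 by rewrite subr_eq0 eq_sym.
  apply: (mulfI z1'); rewrite divff // /Y hornerZ horner_sum.
  under eq_bigr => j _ do rewrite hornerZ hornerXn.
  by rewrite mulrCA sum_mul_expr // mulNr mulrN opprK mulVf.
have L1 := odd_series_lim q1 mo m1 f0 fper fodd fle fs.
have L2 : Clim (fun s => (\sum_(n < 2 * (q * s))
      f n * (1 - zeta (2 * (q * s)) ^+ n)^-1 ^+ m) / (2 * s)%:R ^+ m)
    (\sum_(b < q) f b * (r m).[Y.[zeta q ^+ b]]).
  (* The class n = b + qj gives a power sum with M = 2s, w = zeta_(2s), u = zeta_(2qs)^b and U = u^M
     = zeta_q^b. *)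
  apply: (@Clim_ext_loc 0 (fun s => \sum_(b < q) f b *
    (inv_psum (2 * s) (zeta (2 * (q * s)) ^+ q) (zeta (2 * (q * s)) ^+ b) m /
     (2 * s)%:R ^+ m))).
    move=> s _; rewrite (mulnCA 2 q s).
    rewrite (sum_regroup (fun n => f n * (1 - zeta (q * (2 * s)) ^+ n)^-1 ^+ m)).
    rewrite mulr_suml.
    apply: eq_bigr => b _; rewrite /inv_psum mulrA; congr (_ / _).
    rewrite mulr_sumr; apply: eq_bigr => j _; rewrite fper.
    by rewrite exprD exprM.
  apply: Clim_sum => b _.
  (* The class b = 0 has U = 1, which the limit excludes; there [f 0 = 0] gives a zero
     contribution. *)
  have [b0|bn0] := eqVneq (b : nat) 0%N.
    rewrite b0 f0 mul0r; apply: (@Clim_ext_loc 0 (fun=> 0)); last exact: Clim_const.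
    by move=> s _; rewrite mul0r.
  have bq : (0 < b < q)%N by rewrite lt0n bn0 ltn_ord.
  apply: ClimM; first exact: Clim_const.
  rewrite Yz //; apply: rl.
  - by move=> s; lia.
  - move=> s s0; rewrite (mulnCA 2 q s) (mulnC q) zeta_mulX ?zeta_prim //; lia.
  - move=> s s0; rewrite exprAC (mulnCA 2 q s) zeta_mulX //; lia.
  - by rewrite -(prim_order_dvd (zeta_prim q0)) gtnNdvd //; lia.
have := Clim_uniq L1 L2 => E.
have t0 := tau_neq0.
have qt : (q%:R / tau) ^+ m != 0 by rewrite expf_neq0 // mulf_neq0 ?invr_eq0.
apply: (mulfI (mulf_neq0 n20 qt)); rewrite E.
under [X in _ = _ * (_ * X)]eq_bigr => b _ do rewrite hornerZ horner_comp mulrCA.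
rewrite -mulr_sumr !mulrA; set X := \sum_(_ < q) _.
rewrite expr_div_n -[LHS]mul1r; congr (_ * _).
have qm : (q%:R : C) ^+ m != 0 by rewrite expf_neq0.
have tm : tau ^+ m != 0 by rewrite expf_neq0.
rewrite -!mulrA (mulrA (tau ^- m)) mulVf // mul1r (mulrCA (q%:R ^+ m)) divff // mulr1.
by rewrite divff.
Qed.

(** * Dirichlet characters *)

Lemma dvdn_Zdivide d a : (d %| a)%N <-> (Z.of_nat d | Z.of_nat a)%ZZ.
Proof.
split=> [/dvdnP[k ->]|[k e]]; first by exists (Z.of_nat k); rewrite -Nat2Z.inj_mul.
apply/dvdnP; exists (Z.abs_nat k); apply: Nat2Z.inj.
rewrite -multE Nat2Z.inj_mul Zabs2Nat.id_abs -[X in (_ * X)%ZZ]Z.abs_eq; last by lia.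
by rewrite -Z.abs_mul -e Z.abs_eq //; lia.
Qed.

Lemma Zgcd_of_nat a b : Z.gcd (Z.of_nat a) (Z.of_nat b) = Z.of_nat (gcdn a b).
Proof.
apply: Z.gcd_unique.
- exact: Nat2Z.is_nonneg.
- by apply/dvdn_Zdivide; apply: dvdn_gcdl.
- by apply/dvdn_Zdivide; apply: dvdn_gcdr.
move=> d /Z.divide_abs_l; rewrite -Zabs2Nat.id_abs => /dvdn_Zdivide da.
move=> /Z.divide_abs_l; rewrite -Zabs2Nat.id_abs => /dvdn_Zdivide db.
apply/Z.divide_abs_l; rewrite -Zabs2Nat.id_abs; apply/dvdn_Zdivide.
by rewrite dvdn_gcd da.
Qed.

Lemma natgcdE a b : Nat.gcd a b = gcdn a b.
Proof.
have dvdE d c : Nat.divide d c <-> (d %| c)%N.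
  by split=> [[k ->]|/dvdnP[k ->]]; [rewrite multE dvdn_mull|exists k].
apply/eqP; rewrite eqn_dvd dvdn_gcd; apply/andP; split; first (apply/andP; split).
- by apply/dvdE; apply: Nat.gcd_divide_l.
- by apply/dvdE; apply: Nat.gcd_divide_r.
by apply/dvdE; apply: Nat.gcd_greatest; apply/dvdE; rewrite ?dvdn_gcdl ?dvdn_gcdr.
Qed.

(** [phi] counts over 1..n and the totient over 0..n-1; for n > 1 neither 0 nor n is prime to n. *)
Lemma phi_totient n : (1 < n)%N -> phi n = totient n.
Proof.
move=> n1; rewrite /phi.
have -> (p : pred nat) (s : seq nat) : length (List.filter p s) = count p s.
  by elim: s => //= x s IH; case: (p x) => /=; rewrite IH.
have -> a b : List.seq a b = iota a b by elim: b a => //= b IH a; rewrite IH.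
rewrite totient_count_coprime.
have -> : (\sum_(0 <= d < n) coprime n d)%N = count (coprime n) (iota 0 n).
  rewrite -sum1_count [RHS]big_mkcond /index_iota subn0.
  by apply: eq_bigr => d _; case: coprime.
rewrite (@eq_count _ _ (coprime n)); last first.
  move=> j /=; rewrite natgcdE coprime_sym /coprime.
  by apply/Nat.eqb_spec/eqP.
have c0 : coprime n 0 = false by rewrite /coprime gcdn0; lia.
have cn : coprime n n = false by rewrite /coprime gcdnn; lia.
have : count (coprime n) (0%N :: iota 1 n) = count (coprime n) (iota 0 n ++ [:: n]).
  by congr count; rewrite -[LHS]/(iota 0 n.+1) -addn1 iotaD.
by rewrite count_cat /= c0 cn add0n !addn0.
Qed.

Section DirichletChar.

Variables (q : nat) (chi : Z -> C).
Hypothesis chiP : dirichlet_char q chi.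

Let chi1 : chi 1%ZZ = 1. Proof. by case: chiP. Qed.
Lemma dchiM m n : chi (m * n)%ZZ = chi m * chi n.
Proof. by case: chiP => _ [+ _]; apply. Qed.

Lemma dchi_neq0 (n : nat) : (chi (Z.of_nat n) != 0) = coprime n q.
Proof.
case: chiP => _ [_ [_ /(_ (Z.of_nat n))]]; rewrite Zgcd_of_nat => h.
apply/idP/eqP => [/eqP/h|e].
  by rewrite -[1%ZZ]/(Z.of_nat 1) => /Nat2Z.inj.
by apply/eqP/h; rewrite e.
Qed.

Lemma dchi_modZ (n k : Z) : chi (n + Z.of_nat q * k)%ZZ = chi n.
Proof.
have P (m : Z) : chi (m + Z.of_nat q)%ZZ = chi m by case: chiP => _ [_ [+ _]]; apply.
have N (j : nat) (m : Z) : chi (m + Z.of_nat q * Z.of_nat j)%ZZ = chi m.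
  elim: j m => [|j IH] m; first by congr chi; lia.
  by rewrite -(IH m) -[RHS]P; congr chi; lia.
have [k0|k0] := Z_le_gt_dec 0 k.
  by rewrite -(Z2Nat.id k) // N.
rewrite -(N (Z.to_nat (- k)) (n + Z.of_nat q * k)%ZZ); congr chi; lia.
Qed.

Lemma dchi_mod (a b : nat) : a = b %[mod q] -> chi (Z.of_nat a) = chi (Z.of_nat b).
Proof.
have E (c : nat) : chi (Z.of_nat c) = chi (Z.of_nat (c %% q)).
  rewrite {1}(divn_eq c q) -(dchi_modZ (Z.of_nat (c %% q)) (Z.of_nat (c %/ q))).
  by congr chi; lia.
by move=> ab; rewrite E ab -E.
Qed.

Lemma dchiX (a k : nat) : chi (Z.of_nat a) ^+ k = chi (Z.of_nat (a ^ k)).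
Proof.
elim: k => [|k IH]; first by rewrite expr0 expn0.
by rewrite exprS IH -dchiM expnS; congr chi; lia.
Qed.

Lemma dchi_exp_totient (a : nat) : coprime a q -> chi (Z.of_nat a) ^+ totient q = 1.
Proof.
move=> ca; rewrite dchiX -chi1 -[1%ZZ]/(Z.of_nat 1); apply: dchi_mod.
exact: Euler_exp_totient.
Qed.

Lemma dchiN n : chi (-1)%ZZ = - 1 -> chi (- n)%ZZ = - chi n.
Proof. by move=> chiN; rewrite -[RHS]mulN1r -chiN -dchiM; congr chi; lia. Qed.

Lemma dchi_pred (k n : nat) : chi (-1)%ZZ = - 1 -> (n <= k * q)%N ->
  chi (Z.of_nat (k * q - n)) = - chi (Z.of_nat n).
Proof.
move=> chiN nk; rewrite -dchiN // -(dchi_modZ (- Z.of_nat n) (Z.of_nat k)).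
by congr chi; lia.
Qed.

Hypothesis q_gt2 : (2 < q)%N.

(** A nonzero value is a root of unity, by Euler's theorem. *)
Lemma dchi_le1 (a : nat) : (Cmod (chi (Z.of_nat a)) <= 1)%Re.
Proof.
have [ca|] := boolP (coprime a q); last first.
  by rewrite -dchi_neq0 negbK => /eqP ->; rewrite Cmod_0; lra.
have t0 : (0 < totient q)%N by rewrite totient_gt0; lia.
have := CmodX (chi (Z.of_nat a)) (totient q).
rewrite dchi_exp_totient // -[1%R]/(RtoC 1) Cmod_1 => e.
have [//|gt1] := Rle_lt_dec (Cmod (chi (Z.of_nat a))) 1.
have := Rlt_pow_R1 _ _ gt1 (elimT ltP t0); lra.
Qed.

Lemma dchi0 : chi 0%ZZ = 0.
Proof.
apply/eqP; rewrite -[0%ZZ]/(Z.of_nat 0) -[_ == _]negbK dchi_neq0.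
by rewrite /coprime gcd0n; lia.
Qed.

(** The first term is 1 and the others have modulus at most 1/(n+2)^3 <= 1/(2(n+1)(n+2)). The latter
    telescope to 1/2, so the real parts of the partial sums stay above 1/2. *)
Lemma L_value_neq0 m v : (2 < m)%N -> L_value m chi v -> v != 0.
Proof.
move=> m2 /is_series_Clim [Lv _]; apply/eqP => v0.
move: Lv; rewrite {}v0.
pose a n := (chi (Z.of_nat n.+1) / RtoC (INR n.+1 ^ m)%Re)%C.
rewrite -[fun n => _]/(fun n => fst (sum_n a n)).
have bd n : (- (1 / 2 * / (INR n.+1 * INR n.+2)) <= fst (a n.+1))%Re.
  have n0 := pos_INR n.
  have h : (Cmod (a n.+1) <= / INR n.+2 ^ 3)%Re.
    have n2 : (1 <= INR n.+2)%Re by rewrite !S_INR; lra.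
    rewrite /a Cmod_div; last first.
      by move/(f_equal fst); apply: pow_nonzero => e; lra.
    rewrite Cmod_R Rabs_right; last by apply/Rle_ge/pow_le; lra.
    have p3 : (/ INR n.+2 ^ m <= / INR n.+2 ^ 3)%Re.
      apply: Rinv_le_contravar; first by apply: pow_lt; lra.
      by apply: Rle_pow => //; apply/leP.
    have := dchi_le1 n.+2; have := Cmod_ge_0 (chi (Z.of_nat n.+2)).
    have : (0 < / INR n.+2 ^ m)%Re by apply/Rinv_0_lt_compat/pow_lt; lra.
    by rewrite /Rdiv; move: (Cmod _) p3 => c; nra.
  have h2 : (/ INR n.+2 ^ 3 <= 1 / 2 * / (INR n.+1 * INR n.+2))%Re.
    rewrite (_ : (1 / 2 * / (INR n.+1 * INR n.+2))%Re = (/ (2 * (INR n.+1 * INR n.+2)))%Re).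
      apply: Rinv_le_contravar; rewrite !S_INR; nra.
    by rewrite !S_INR; field; lra.
  have : (Rabs (fst (a n.+1)) <= Cmod (a n.+1))%Re by exact: (re_le_Cmod (a n.+1)).
  rewrite /Rabs.
  case: Rcase_abs; lra.
have a0 : fst (a 0%N) = 1%Re.
  by rewrite /a -[Z.of_nat 1]/1%ZZ chi1 pow1 /=; field.
(* The telescoped remainder 1/(2(n+1)) is kept in the bound so that the induction closes. *)
have sb n : (1 / 2 <= fst (sum_n a n) - 1 / 2 * / INR n.+1)%Re.
  elim: n => [|n IH]; first by rewrite sum_O a0 /=; lra.
  rewrite sum_Sn -[fst (plus _ _)]/(fst (sum_n a n) + fst (a n.+1))%Re.
  have := bd n; have n0 := pos_INR n.
  have : (/ (INR n.+1 * INR n.+2) = / INR n.+1 - / INR n.+2)%Re.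
    by rewrite !S_INR; field; lra.
  lra.
move=> L0.
have : Rbar_le (1 / 2)%Re 0%Re.
  apply: is_lim_seq_le (is_lim_seq_const _) L0 => n.
  have := sb n; have : (0 < / INR n.+1)%Re by apply/Rinv_0_lt_compat/INR_gt0.
  lra.
rewrite /=; lra.
Qed.

(** Multiplication by b permutes the residues mod q, and chi(ab) = chi(a) chi(b). *)
Lemma sum_twist (S : {poly C}) b : coprime b q ->
  \sum_(a < q) chi (Z.of_nat a) * S.[zeta q ^+ (a * b)] =
  (chi (Z.of_nat b))^-1 * \sum_(a < q) chi (Z.of_nat a) * S.[zeta q ^+ a].
Proof.
move=> cb; have q0 : (0 < q)%N by lia.
have cb0 : chi (Z.of_nat b) != 0 by rewrite dchi_neq0.
apply: (mulfI cb0); rewrite mulrA divff // mul1r.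
pose h (a : 'I_q) := Ordinal (ltn_pmod (a * b) q0).
have h_inj : injective h.
  move=> a a' [e]; apply: val_inj => /=.
  wlog aa : a a' e / (a <= a')%N.
    by move=> W; case: (leqP a a') => [|/ltnW] aa; [|symmetry]; apply: W.
  have : (q %| a' * b - a * b)%N by rewrite -eqn_mod_dvd ?leq_mul2r ?aa ?orbT // e.
  rewrite -mulnBl Gauss_dvdl; last by rewrite coprime_sym.
  have := ltn_ord a' => a'q d.
  have : (a' - a = 0)%N.
    by apply/eqP; apply: contraTT d; rewrite -lt0n => d; rewrite gtnNdvd //; lia.
  lia.
rewrite [RHS](reindex_inj h_inj) mulr_sumr; apply: eq_bigr => a _ /=.
rewrite prim_expr_mod; last exact: zeta_prim.
rewrite mulrA [chi _ * chi _]mulrC -dchiM; congr (_ * _).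
by rewrite (@dchi_mod _ (a * b)%N) ?modn_mod //; congr chi; lia.
Qed.

End DirichletChar.

(** * Independence of distinct multiplicative functions *)

Section ArtinIndependence.

Variables (T : eqType) (K : fieldType) (D : pred nat) (x : T -> nat -> K).
Hypotheses (D1 : D 1%N) (DM : forall a b, D a -> D b -> D (a * b)%N).
Hypothesis x1 : forall t, x t 1%N = 1.
Hypothesis xM : forall t a b, x t (a * b)%N = x t a * x t b.
Hypothesis x_sep : forall t t', t != t' -> exists2 b, D b & x t b != x t' b.

(** Artin's argument: from the relation at b1 b, subtract [x t0 b1] times the relation at b. The t0
    term cancels, and the coefficient of t1 is multiplied by a nonzero difference when b1 separates
    t1 from t0. *)
Lemma artin_independence (s : seq T) (e : T -> K) : uniq s ->
  (forall b, D b -> \sum_(t <- s) e t * x t b = 0) -> {in s, forall t, e t = 0}.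
Proof.
elim: s e => // t0 s IH e /= /andP[t0s us] rel.
have es : {in s, forall t, e t = 0}.
  move=> t1 t1s; have [|b1 Db1 nb1] := @x_sep t1 t0.
    by apply: contraNneq t0s => <-.
  suff rel' b : D b -> \sum_(t <- s) e t * (x t b1 - x t0 b1) * x t b = 0.
    have /eqP := IH _ us rel' t1 t1s.
    by rewrite mulf_eq0 subr_eq0 (negPf nb1) orbF => /eqP.
  move=> Db.
  have := rel _ (DM Db1 Db); have := rel _ Db; rewrite !big_cons => r1 r2.
  transitivity ((e t0 * x t0 (b1 * b)%N + \sum_(t <- s) e t * x t (b1 * b)%N) -
     x t0 b1 * (e t0 * x t0 b + \sum_(t <- s) e t * x t b)); last first.
    by rewrite r1 r2 mulr0 subrr.
  rewrite mulrDr opprD addrACA xM mulrCA subrr add0r mulr_sumr -sumrB.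
  by apply: eq_bigr => t _; rewrite xM mulrBr mulrBl mulrA mulrCA mulrA.
move=> t; rewrite in_cons => /predU1P[->|]; last exact: es.
have := rel _ D1; rewrite big_cons x1 mulr1 big_seq big1 ?addr0 // => t' t's.
by rewrite es ?mul0r.
Qed.

End ArtinIndependence.

(** * Linear independence *)

Lemma gen_field_subfield S : subfieldC (gen_field S).
Proof.
split; first by move=> F [? _].
split; first by move=> F [_ [? _]].
split.
  move=> x y Sx Sy F HF SF; have [_ [_ [+ _]]] := HF.
  by apply; [apply: Sx|apply: Sy].
split; first by move=> x Sx F HF SF; have [_ [_ [_ [+ _]]]] := HF; apply; apply: Sx.
split.
  move=> x y Sx Sy F HF SF; have [_ [_ [_ [_ [+ _]]]]] := HF.
  by apply; [apply: Sx|apply: Sy].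
by move=> x Sx x0 F HF SF; have [_ [_ [_ [_ [_ +]]]]] := HF; apply => //; apply: Sx.
Qed.

(** * Subfields of C as boolean predicates, and their images in [complex R] *)

Section SubfieldPred.

Variables (F : C -> Prop) (FP : subfieldC F).

Definition subfield_pred : {pred C} := fun x => `[< F x >].

Lemma subfield_pred_divring : GRing.divring_closed subfield_pred.
Proof.
case: FP => F0 [F1 [FD [FN [FM FV]]]].
split=> [|x y /asboolP Fx /asboolP Fy|x y /asboolP Fx /asboolP Fy].
- exact/asboolP.
- by apply/asboolP; apply: FD => //; apply: FN.
- apply/asboolP; apply: FM => //; have [->|y0] := eqVneq y 0; first by rewrite invr0.
  by apply: FV => //; apply/eqP.
Qed.

Definition subfield_divring : divringClosed C :=
  HB.pack subfield_pred (GRing.isDivringClosed.Build C subfield_pred subfield_pred_divring).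

Lemma subfield_divringE x : (x \in subfield_divring) = `[< F x >].
Proof. by []. Qed.

Definition complex_pred : {pred complex R} :=
  fun x => subfield_pred (complex.Re x, complex.Im x).

Lemma complex_predE x : (c2c x \in complex_pred) = `[< F x >].
Proof. by case: x. Qed.

Lemma complex_pred_divring : GRing.divring_closed complex_pred.
Proof.
have E z : c2c (complex.Re z, complex.Im z) = z by case: z.
have [h1 hB hM] := subfield_pred_divring.
split=> [|x y Fx Fy|x y Fx Fy].
- by rewrite -[1](rmorph1 c2c) complex_predE; exact: h1.
- by rewrite -(E x) -(E y) -rmorphB complex_predE; apply: hB.
- by rewrite -(E x) -(E y) -fmorph_div complex_predE; apply: hM.
Qed.

Definition complex_divring : divringClosed (complex R) :=
  HB.pack complex_pred (GRing.isDivringClosed.Build _ complex_pred complex_pred_divring).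

End SubfieldPred.

Section RealPart.

Definition real_pred : {pred complex R} := fun x => complex.Im x == 0.

Lemma real_pred_subring : GRing.subring_closed real_pred.
Proof.
split=> [|[a b] [c d] /eqP /= b0 /eqP /= d0|[a b] [c d] /eqP /= b0 /eqP /= d0].
- exact/eqP.
- by apply/eqP; rewrite /= b0 d0 subr0.
- by apply/eqP; rewrite /= b0 d0 mulr0 mul0r addr0.
Qed.

End RealPart.

Lemma is_ratC_ratr x : is_ratC x -> exists r : rat, c2c x = ratr r.
Proof.
have Z2 (p : Z) : exists r : rat, c2c (RtoC (IZR p)) = ratr r.
  have N2 (n : nat) : c2c (RtoC (IZR (Z.of_nat n))) = ratr (n%:R : rat).
    by rewrite -INR_IZR_INZ -natrC rmorph_nat ratr_nat.
  have [p0|p0] := Z_le_gt_dec 0 p.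
    by exists ((Z.to_nat p)%:R); rewrite -N2 Z2Nat.id.
  exists (- (Z.to_nat (- p))%:R); rewrite rmorphN /= -N2 Z2Nat.id; last by lia.
  rewrite -rmorphN; congr c2c; rewrite opp_IZR RtoC_opp.
  exact: (esym (opprK _)).
case=> p [q [q0 ->]]; have [r rE] := Z2 p; have [s sE] := Z2 q.
exists (r / s); rewrite fmorph_div /= -rE -sE -fmorph_div; congr c2c.
rewrite RtoC_div //; exact: not_0_IZR.
Qed.

(** [odd_vanishing_conjugate] carried over through [c2c], with E the set of real elements of
    Q(zeta_n). *)
Lemma odd_vanishing_C (F : C -> Prop) (FP : subfieldC F) n (W : {poly C}) b :
  (2 < n)%N ->
  (forall x, F x -> cyclo_plus n x -> is_ratC x) ->
  W \is a polyOver (subfield_divring FP) ->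
  (forall a, coprime a n -> W.[zeta n ^- a] = - W.[zeta n ^+ a]) ->
  W.[zeta n] = 0 -> coprime b n -> W.[zeta n ^+ b] = 0.
Proof.
move=> n2 FE WF Wodd Wz cb; have n0 : (0 < n)%N by lia.
have CP := gen_field_subfield (fun x => x = zeta n).
pose Ep : {pred complex R} := fun x => (x \in complex_divring CP) && real_pred x.
have EP : GRing.subring_closed Ep.
  have [h1 hB hM] := real_pred_subring.
  split=> [|x y /andP[x1 x2] /andP[y1 y2]|x y /andP[x1 x2] /andP[y1 y2]].
  - by apply/andP; split; [exact: rpred1|exact: h1].
  - by apply/andP; split; [exact: rpredB|exact: hB].
  - by apply/andP; split; [exact: rpredM|exact: hM].
pose E : subringClosed (complex R) := HB.pack Ep (GRing.isSubringClosed.Build _ Ep EP).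
have zP : n.-primitive_root (c2c (zeta n)).
  by rewrite fmorph_primitive_root; apply: zeta_prim.
have zC : zeta n \in subfield_divring CP by apply/asboolP => G _; apply.
have zE j : c2c (zeta n) ^+ j + c2c (zeta n) ^- j \in E.
  rewrite -rmorphXn -fmorphV -rmorphD; apply/andP; split.
    rewrite complex_predE -subfield_divringE rpredD ?rpredV //; exact: rpredX.
  apply/eqP; rewrite zetaX; set t := (_ * INR j)%Re.
  rewrite /= -/(cos t) -/(sin t).
  have := sin2_cos2 t; rewrite /Rsqr => e.
  rewrite -[LHS]/(sin t + - sin t / (cos t * (cos t * 1) + sin t * (sin t * 1)))%Re.
  by rewrite !Rmult_1_r (Rplus_comm (cos t * cos t)) e Rdiv_1_r; exact: Rplus_opp_r.
have FE' x : x \in complex_divring FP -> x \in E -> exists r : rat, x = ratr r.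
  have {1 2 3}-> : x = c2c (complex.Re x, complex.Im x) by case: x.
  set y := (_, _); rewrite complex_predE => /asboolP Fy /andP[].
  rewrite complex_predE => /asboolP Cy /eqP yR.
  by apply: is_ratC_ratr; apply: FE.
have cE m : c2c (zeta n) ^+ m = c2c (zeta n ^+ m) by rewrite rmorphXn.
have := @odd_vanishing_conjugate _ (complex_divring FP) E n _ n2 zP zE FE' (map_poly c2c W) b.
move=> H; apply: (fmorph_inj c2c); rewrite rmorph0 -horner_map /= -cE; apply: H => //.
- apply/polyOverP => i; rewrite coef_map complex_predE -subfield_divringE.
  exact: (polyOverP WF).
- move=> a ca; rewrite cE -fmorphV !horner_map Wodd // rmorphN //.
- by rewrite horner_map Wz rmorph0.
Qed.

(** * Independence of the L-values for several moduli *)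

Section Independence.

Variables (l m : nat) (q : nat -> nat) (F : C -> Prop) (FP : subfieldC F).
Hypotheses (m_odd : odd m) (m_gt2 : (2 < m)%N) (l_gt0 : (0 < l)%N).
Hypothesis q_gt2 : forall i, (i < l)%N -> (2 < q i)%N.
Hypothesis q_coprime : forall i j, (i < l)%N -> (j < l)%N -> i <> j ->
  coprime (q i) (q j).

Let Q := (\prod_(j < l) q j)%N.

Hypothesis F_real : forall x, F x -> cyclo_plus Q x -> is_ratC x.
Hypothesis F_zeta : forall i, (i < l)%N -> F (zeta (totient (q i))).

(** The cofactor Q/q_i: raising zeta_Q to it gives zeta_(q_i), and every other q_j divides it. *)
Let R i := (\prod_(j < l | j != i) q j)%N.

Let QE (i : 'I_l) : Q = (q i * R i)%N.
Proof. by rewrite /Q (bigD1 i). Qed.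

Let qR (i : 'I_l) : coprime (q i) (R i).
Proof.
apply: (big_ind (fun x => coprime (q i) x)) => [|x y|j ji].
- exact: coprimen1.
- by rewrite coprimeMr => -> ->.
- by apply: q_coprime => // e; move/eqP: ji; apply; apply: val_inj.
Qed.

Let q_dvd_R (i j : 'I_l) : j != i -> (q j %| R i)%N.
Proof. by move=> ji; rewrite /R (bigD1 j) //= dvdn_mulr. Qed.

Let R_gt0 (i : 'I_l) : (0 < R i)%N.
Proof. by rewrite prodn_gt0 // => j; have := q_gt2 (ltn_ord j); lia. Qed.

Let zetaQ (i : 'I_l) : zeta Q ^+ R i = zeta (q i).
Proof. by rewrite (QE i) zeta_mulX //; have := q_gt2 (ltn_ord i); lia. Qed.

Let Q_gt2 : (2 < Q)%N.
Proof.
pose i := Ordinal l_gt0; have := q_gt2 (ltn_ord i); have := R_gt0 i.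
rewrite (QE i) => R0 q2; apply: leq_trans q2 _.
by rewrite leq_pmulr.
Qed.

(** The Chinese remainder theorem lifts r to a b prime to Q that is invisible to the other
    moduli. *)
Lemma crt_coprime (i : 'I_l) r : coprime r (q i) ->
  exists b, [/\ coprime b Q, b = r %[mod q i] & b = 1 %[mod R i]].
Proof.
move=> cr; exists (chinese (q i) (R i) r 1); split.
- rewrite (QE i) coprimeMr; apply/andP; split.
    by rewrite -coprime_modl chinese_modl // coprime_modl.
  by rewrite -coprime_modl chinese_modr // coprime_modl coprime1n.
- exact: chinese_modl.
- exact: chinese_modr.
Qed.

(** A nonzero value is a power of the root of unity of order [totient (q i)], which lies in F. *)
Lemma dchi_in_F (i : 'I_l) chi a : dirichlet_char (q i) chi -> F (chi (Z.of_nat a)).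
Proof.
move=> chiP; have qi := q_gt2 (ltn_ord i).
have t0 : (0 < totient (q i))%N by rewrite totient_gt0; lia.
apply/asboolP; rewrite -(subfield_divringE FP).
have [ca|] := boolP (coprime a (q i)); last first.
  by rewrite -(dchi_neq0 chiP) negbK => /eqP ->; rewrite rpred0.
have [k ->] := prim_rootP (zeta_prim t0) (dchi_exp_totient chiP ca).
by apply: rpredX; apply/asboolP; apply: F_zeta.
Qed.

Lemma odd_L_value (i : 'I_l) :
  exists S : {poly C}, (forall F : divringClosed C, S \is a polyOver F) /\
  forall chi v, dirichlet_char (q i) chi -> chi (-1)%ZZ = - 1 -> L_value m chi v ->
    v = (tau ^+ m / 2) *
        \sum_(a < q i) chi (Z.of_nat a) * S.[zeta (q i) ^+ a].
Proof.
have qi := q_gt2 (ltn_ord i).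
have [S [SF SP]] := @odd_series_value (q i) m ltac:(lia) m_odd ltac:(lia).
exists S; split=> // chi v chiP chiN Lv.
apply: (SP (fun n => chi (Z.of_nat n))).
- exact: dchi0 chiP qi.
- by move=> b j; apply: (dchi_mod chiP); rewrite mulnC addnC modnMDl.
- by move=> k n; apply: (dchi_pred chiP).
- by move=> n; apply: dchi_le1 chiP qi _.
- apply: is_series_ext Lv => n; rewrite natrC -RtoCX //.
Qed.

Lemma odd_L_value_independence n (c v : 'I_n -> C) : injective v ->
  (forall t, exists2 i, (i < l)%N & X_odd (q i) m (v t)) ->
  (forall t, F (c t)) -> \sum_t c t * v t = 0 -> forall t, c t = 0.
Proof.
move=> v_inj vX cF rel.
have /choice[g gP] t : exists p : 'I_l * (Z -> C), [/\ dirichlet_char (q p.1) p.2,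
    p.2 (-1)%ZZ = - 1 & L_value m p.2 (v t)].
  by have [i il [chi [h1 [h2 h3]]]] := vX t; exists (Ordinal il, chi).
pose i t := (g t).1; pose chi t := (g t).2.
have chiP t : dirichlet_char (q (i t)) (chi t) by case: (gP t).
have chiN t : chi t (-1)%ZZ = - 1 by case: (gP t).
have Lv t : L_value m (chi t) (v t) by case: (gP t).
have qi t : (2 < q (i t))%N := q_gt2 (ltn_ord (i t)).
have chi1 t : chi t 1%ZZ = 1 by case: (chiP t).
have /choice[S SP] t := odd_L_value (i t).
pose G t := \sum_(a < q (i t)) chi t (Z.of_nat a) * (S t).[zeta (q (i t)) ^+ a].
have vE t : v t = tau ^+ m / 2 * G t by apply: (proj2 (SP t)).
have k0 : tau ^+ m / 2 != 0.
  by rewrite mulf_neq0 ?expf_neq0 ?tau_neq0 // invr_eq0 natrC_neq0.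
have G0 t : G t != 0.
  have := L_value_neq0 (chiP t) (qi t) m_gt2 (Lv t).
  by rewrite vE mulf_eq0 negb_or => /andP[].
(* Substituting X^(a R_i) expresses zeta_(q_i)^a through the single root zeta_Q, so the whole
   relation becomes the vanishing of one polynomial over F at zeta_Q. *)
pose W := \sum_t c t *: \sum_(a < q (i t))
  chi t (Z.of_nat a) *: (S t \Po 'X^(a * R (i t))).
have WF : W \is a polyOver (subfield_divring FP).
  rewrite rpred_sum // => t _; rewrite polyOverZ //; first exact/asboolP.
  rewrite rpred_sum // => a _; rewrite polyOverZ //.
    by apply/asboolP; apply: dchi_in_F.
  by rewrite polyOver_comp ?polyOverXn //; apply: (proj1 (SP t)).
have copQ t b : coprime b Q -> coprime b (q (i t)).
  by rewrite (QE (i t)) coprimeMr => /andP[].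
have WE b : coprime b Q ->
    W.[zeta Q ^+ b] = \sum_t c t * G t * (chi t (Z.of_nat b))^-1.
  move=> cb; rewrite horner_sum; apply: eq_bigr => t _.
  rewrite hornerZ horner_sum -mulrA [G t * _]mulrC; congr (_ * _).
  rewrite -(sum_twist (chiP t) (qi t)) ?copQ //; apply: eq_bigr => a _.
  rewrite hornerZ horner_comp hornerXn; congr (_ * _.[_]).
  by rewrite -(zetaQ (i t)) -!exprM; congr (_ ^+ _); lia.
have Wz : W.[zeta Q] = 0.
  rewrite -[zeta Q]expr1 WE ?coprime1n //; apply: (mulfI k0); rewrite mulr0 -[RHS]rel.
  rewrite mulr_sumr; apply: eq_bigr => t _.
  by rewrite -[Z.of_nat 1]/1%ZZ chi1 invr1 mulr1 vE mulrCA.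
have Q0 : (0 < Q)%N by apply: leq_trans Q_gt2.
have z0 : zeta Q != 0.
  apply/eqP => z0; move: (zeta_expn Q0) => /eqP.
  by rewrite z0 expr0n gtn_eqF // eq_sym oner_eq0.
(* The inverse of zeta_Q^a is zeta_Q^(a(Q-1)), and Q - 1 is -1 modulo every q_i, where the
   characters take the value -1. *)
have Wodd a : coprime a Q -> W.[zeta Q ^- a] = - W.[zeta Q ^+ a].
  move=> ca; have -> : zeta Q ^- a = zeta Q ^+ (a * Q.-1).
    apply: (mulIf (expf_neq0 a z0)); rewrite mulVf ?expf_neq0 // -exprD -mulnSr prednK //.
    by rewrite mulnC exprM zeta_expn // expr1n.
  have cQ1 : coprime Q.-1 Q by rewrite -{2}(prednK Q0) coprimenS.
  rewrite !WE //; last by rewrite coprimeMl ca.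
  rewrite -sumrN; apply: eq_bigr => t _; rewrite -mulrN -invrN; congr (_ * _^-1).
  have -> : Z.of_nat (a * Q.-1) = (Z.of_nat a * Z.of_nat Q.-1)%ZZ by lia.
  rewrite (dchiM (chiP t)) -mulrN1; congr (_ * _).
  rewrite -subn1 (QE (i t)) mulnC (dchi_pred (chiP t)) ?chi1 //.
  by rewrite mulnC -QE.
have rel_b b : coprime b Q -> \sum_t c t * G t * (chi t (Z.of_nat b))^-1 = 0.
  by move=> cb; rewrite -WE //; apply: odd_vanishing_C Q_gt2 F_real WF Wodd Wz cb.
have sep t t' : t != t' ->
    exists2 b, coprime b Q & (chi t (Z.of_nat b))^-1 != (chi t' (Z.of_nat b))^-1.
  move=> tt'; suff [b cb nb] : exists2 b, coprime b Q &
      chi t (Z.of_nat b) != chi t' (Z.of_nat b).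
    by exists b => //; rewrite (inj_eq invr_inj).
  (* For equal moduli, equal characters would have the same L-value, against injectivity of [v].
     They differ at some k, prime to the modulus because both vanish elsewhere, and k lifts to a b
     prime to Q. *)
  have [ii|ii] := eqVneq (i t') (i t).
    have [k nk] : exists k : Z, chi t k <> chi t' k.
      apply: contrapT => /forallNP same; move/negP: tt'; apply; apply/eqP/v_inj.
      apply: Clim_uniq (is_series_Clim (Lv t)) _.
      apply: is_series_Clim; apply: is_series_ext (Lv t') => s.
      by rewrite (contrapT (same (Z.of_nat s.+1))).
    pose a := Z.to_nat (k mod Z.of_nat (q (i t)))%ZZ.
    have aE : k = (Z.of_nat a + Z.of_nat (q (i t)) * (k / Z.of_nat (q (i t))))%ZZ.
      rewrite /a Z2Nat.id.
        by have := Z.div_mod k (Z.of_nat (q (i t))); have := qi t; lia.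
      by apply: (proj1 (Z.mod_pos_bound _ _ _)); have := qi t; lia.
    have aE1 : chi t k = chi t (Z.of_nat a) by rewrite {1}aE (dchi_modZ (chiP t)).
    have aE2 : chi t' k = chi t' (Z.of_nat a).
      by rewrite {1}aE; have := chiP t'; rewrite ii => h; rewrite (dchi_modZ h).
    have ca : coprime a (q (i t)).
      apply: contrapT => /negP nc; apply: nk; rewrite aE1 aE2.
      have /eqP -> : chi t (Z.of_nat a) == 0.
        by rewrite -[_ == _]negbK (dchi_neq0 (chiP t)).
      apply/esym/eqP; have := chiP t'; rewrite ii => h.
      by rewrite -[_ == _]negbK (dchi_neq0 h).
    have [b [cb ba _]] := crt_coprime ca.
    exists b => //; rewrite (dchi_mod (chiP t) ba).
    have := chiP t'; rewrite ii => h; rewrite (dchi_mod h ba).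
    by apply/eqP; rewrite -aE1 -aE2.
  (* For distinct moduli, take b congruent to -1 modulo the first and to 1 modulo the second: the
     odd characters then take the values -1 and 1. *)
  have cq1 : coprime (q (i t)).-1 (q (i t)).
    by rewrite -{2}(prednK (ltnW (ltnW (qi t)))) coprimenS.
  have [b [cb bq bR]] := crt_coprime cq1.
  exists b => //; rewrite (dchi_mod (chiP t) bq).
  have -> : chi t (Z.of_nat (q (i t)).-1) = - 1.
    rewrite -subn1 -[X in (X - 1)%N]mul1n (dchi_pred (chiP t)) ?chi1 // mul1n.
    exact: ltnW (ltnW (qi t)).
  have b1 : b = 1 %[mod q (i t')].
    by rewrite -(modn_dvdm b (q_dvd_R ii)) bR modn_dvdm ?q_dvd_R.
  rewrite (dchi_mod (chiP t') b1) -[Z.of_nat 1]/1%ZZ chi1.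
  by rewrite eq_sym -subr_eq0 opprK; exact: (@natrC_neq0 2).
move=> t; apply/eqP; have : c t * G t = 0.
  apply: (@artin_independence _ _ (coprime^~ Q) (fun t b => (chi t (Z.of_nat b))^-1)
     _ _ _ _ sep (index_enum _) (fun t => c t * G t)).
  - exact: coprime1n.
  - by move=> a b ca cb; rewrite coprimeMl ca.
  - by move=> s; rewrite -[Z.of_nat 1]/1%ZZ chi1 invr1.
  - move=> s a b; rewrite -invfM -(dchiM (chiP s)).
    by congr (chi s _)^-1; lia.
  - exact: index_enum_uniq.
  - exact: rel_b.
  - exact: mem_index_enum.
by move/eqP; rewrite mulf_eq0 (negPf (G0 t)) orbF.
Qed.

End Independence.

(** * From indexed families to lists *)

Lemma prodnE l f : prodn l f = (\prod_(j < l) f j)%N.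
Proof.
have E a b : List.fold_right Nat.mul 1%N (List.map f (List.seq a b)) =
    (\prod_(a <= j < a + b) f j)%N.
  elim: b a => [|b IH] a /=; first by rewrite addn0 big_geq.
  by rewrite IH addnS [RHS]big_ltn ?ltnS ?leq_addr // addSn.
by rewrite /prodn E add0n big_mkord.
Qed.

Lemma lincombE (cs xs : seq C) : length cs = length xs ->
  lincomb cs xs = \sum_(t < size xs) cs`_t * xs`_t.
Proof.
elim: cs xs => [|c cs IH] [|x xs] //=; first by rewrite big_ord0.
by case=> e; rewrite big_ord_recl /= -IH.
Qed.

Lemma Forall_nth (P : C -> Prop) (s : seq C) :
  List.Forall P s <-> forall t, (t < size s)%N -> P s`_t.
Proof.
split=> [|h]; first by elim=> // x s' Px _ IH [|t] //=; apply: IH.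
elim: s h => [|x s IH] h; first by constructor.
by constructor; [apply: (h 0%N)|apply: IH => t; apply: (h t.+1)].
Qed.

Lemma NoDup_uniq (s : seq C) : List.NoDup s -> uniq s.
Proof.
elim=> //= x s' nx _ ->; rewrite andbT; apply/negP => xs; apply: nx.
elim: s' xs => //= y s' IH; rewrite in_cons => /predU1P[->|/IH]; by [left|right].
Qed.

Lemma odd_L_values_lin_indep (l : nat) (q : nat -> nat) (k : nat) (K : C -> Prop) :
  (1 <= l)%coq_nat ->
  (forall i, (i < l)%coq_nat -> (2 < q i)%coq_nat) ->
  (forall i j, (i < l)%coq_nat -> (j < l)%coq_nat -> i <> j ->
     Nat.gcd (q i) (q j) = 1%N) ->
  (1 <= k)%coq_nat ->
  number_field K ->
  (forall z, (adjoin K (zeta (prodn l (fun i => phi (q i)))) z /\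
              cyclo_plus (prodn l q) z) <-> is_ratC z) ->
  lin_indep_over (adjoin K (zeta (prodn l (fun i => phi (q i)))))
    (fun z => exists i, (i < l)%coq_nat /\ X_odd (q i) (2 * k + 1) z).
Proof.
move=> /leP l0 q2 qc /leP k1 _ FE xs cs scx ux Sxs Fcs rel.
set F := adjoin _ _ in FE Fcs *.
have FP : subfieldC F by apply: gen_field_subfield.
have q2' i : (i < l)%N -> (2 < q i)%N by move=> /ltP il; apply/ltP; apply: q2.
have qc' i j : (i < l)%N -> (j < l)%N -> i <> j -> coprime (q i) (q j).
  by move=> /ltP il /ltP jl ij; rewrite /coprime -natgcdE qc.
have t0 i : (i < l)%N -> (0 < totient (q i))%N.
  by move=> /q2' qi; rewrite totient_gt0; lia.
(* The adjoined root has as order the product of all totients; its power by the product of the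
   others is the root needed for q_i. *)
have Fz i : (i < l)%N -> F (zeta (totient (q i))).
  move=> il; have -> : zeta (totient (q i)) =
      zeta (prodn l (fun i => phi (q i))) ^+ (\prod_(j < l | j != Ordinal il) totient (q j)).
    rewrite prodnE (eq_bigr (fun j : 'I_l => totient (q j))); last first.
      by move=> j _; rewrite phi_totient //; have := q2' _ (ltn_ord j); lia.
    rewrite (bigD1 (Ordinal il)) //= zeta_mulX ?t0 //.
    by rewrite prodn_gt0 // => j; apply: t0.
  apply/asboolP; rewrite -(subfield_divringE FP) rpredX //.
  by apply/asboolP => G _; apply; right.
have len (s : seq C) : length s = size s by [].
have scx' : size cs = size xs by rewrite -!len.
rewrite lincombE // in rel.
apply/Forall_nth => t; rewrite scx' => tx.
apply: (@odd_L_value_independence l (2 * k + 1) q F FP _ _ l0 q2' qc' _ Fz (size xs)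
   (fun t => cs`_t) (fun t => xs`_t) _ _ _ rel (Ordinal tx)).
- by rewrite addn1 /= mul2n odd_double.
- by lia.
- by move=> x Fx; rewrite -prodnE => Cx; apply/FE.
- by move=> a b /eqP; rewrite nth_uniq ?NoDup_uniq // => /eqP/val_inj.
- move=> a; have /Forall_nth/(_ a (ltn_ord a))[i [/ltP il Xi]] := Sxs.
  by exists i.
- by move=> a; move/Forall_nth: Fcs; apply; rewrite scx'.
Qed.

End OddLValues.

Theorem theorem1p3 (l : nat) (q : nat -> nat) (k : nat) (K : C -> Prop) :
  (1 <= l)%nat ->
  (forall i, (i < l)%nat -> (2 < q i)%nat) ->
  (forall i j, (i < l)%nat -> (j < l)%nat -> i <> j -> Nat.gcd (q i) (q j) = 1%nat) ->
  (1 <= k)%nat ->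
  number_field K ->
  (forall z, (adjoin K (zeta (prodn l (fun i => phi (q i)))) z /\
              cyclo_plus (prodn l q) z) <-> is_ratC z) ->
  lin_indep_over (adjoin K (zeta (prodn l (fun i => phi (q i)))))
    (fun z => exists i, (i < l)%nat /\ X_odd (q i) (2 * k + 1) z).
Proof. exact (@OddLValues.odd_L_values_lin_indep l q k K). Qed.
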